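(* Let $k$ be a field and let $Q$ be a quiver. Then the path coalgebra $kQ$ admits a coquasitriangular Majid algebra structure (i.e. there is a coquasitriangular Majid algebra whose underlying coalgebra is $kQ$) if and only if $Q$ is a Hopf quiver of the form $Q(G,R)$, where $G$ is an abelian group and $R$ is a ramification datum of $G$.
   Context: All spaces and tensor products are over the field $k$; Sweedler notation $\Delta(a)=a_1\otimes a_2$ (summation understood) and its iterates are used. Quiver: $Q=(Q_0,Q_1,s,t)$ with set of vertices $Q_0$, set of arrows $Q_1$, source and target maps $s,t:Q_1\to Q_0$. A path of length $l\ge 1$ is $a_l\cdots a_1$ with $s(a_{i+1})=t(a_i)$; vertices are the paths of length $0$. The path coalgebra $kQ$ has basis all paths; vertices are group-like, and $\Delta(a_l\cdots a_1)=t(a_l)\otimes a_l\cdots a_1+\sum_{i=1}^{l-1}a_l\cdots a_{i+1}\otimes a_i\cdots a_1+a_l\cdots a_1\otimes s(a_1)$; $\varepsilon$ is $1$ on vertices and $0$ on paths of positive length. Hopf quiver: for a group $G$ with set of conjugacy classes $\mathcal C$, a ramification datum is a formal sum $R=\sum_{C\in\mathcal C}R_C C$ with $R_C\in\mathbb N=\{0,1,2,\dots\}$. The Hopf quiver $Q(G,R)$ has vertex set $G$ and, for each $x\in G$, $C\in\mathcal C$ and $c\in C$, exactly $R_C$ arrows from $x$ to $cx$. Majid algebra (dual of a quasi-Hopf algebra): a coalgebra $(H,\Delta,\varepsilon)$ with coalgebra maps $H\otimes H\to H$, $a\otimes b\mapsto ab$, and $k\to H$ (unit $1$), and a convolution-invertible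 map $\Phi:H^{\otimes 3}\to k$ (associator) such that $1a=a=a1$, $a_1(b_1c_1)\Phi(a_2,b_2,c_2)=\Phi(a_1,b_1,c_1)(a_2b_2)c_2$, $\Phi(a_1,b_1,c_1d_1)\Phi(a_2b_2,c_2,d_2)=\Phi(b_1,c_1,d_1)\Phi(a_1,b_2c_2,d_2)\Phi(a_2,b_3,c_3)$, $\Phi(a,1,b)=\varepsilon(a)\varepsilon(b)$, and such that there exists a quasi-antipode: a coalgebra antimorphism $S:H\to H$ and functionals $\alpha,\beta:H\to k$ with $S(a_1)\alpha(a_2)a_3=\alpha(a)1$, $a_1\beta(a_2)S(a_3)=\beta(a)1$, $\Phi(a_1,S(a_3),a_5)\beta(a_2)\alpha(a_4)=\varepsilon(a)$, $\Phi^{-1}(S(a_1),a_3,S(a_5))\alpha(a_2)\beta(a_4)=\varepsilon(a)$. Coquasitriangular Majid algebra: a Majid algebra $(H,\Phi)$ with a convolution-invertible map $\mathcal R:H\otimes H\to k$ such that for all $a,b,c\in H$: $\mathcal R(ab,c)=\Phi(c_1,a_1,b_1)\mathcal R(a_2,c_2)\Phi^{-1}(a_3,c_3,b_2)\mathcal R(b_3,c_4)\Phi(a_4,b_4,c_5)$, $\mathcal R(a,bc)=\Phi^{-1}(b_1,c_1,a_1)\mathcal R(a_2,c_2)\Phi(b_2,a_3,c_3)\mathcal R(a_4,b_3)\Phi^{-1}(a_5,b_4,c_4)$, $b_1a_1\mathcal R(a_2,b_2)=\mathcal R(a_1,b_1)a_2b_2$.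
   Formalization: The quiver Q is assumed to have only finitely many arrows between any two vertices; otherwise the ''only if'' fails, e.g. for one vertex with infinitely many loops, where the shuffle product gives a structure although each R_C is a natural number. *)

(* Defs.v *)
From HB Require Import structures.
From mathcomp Require Import all_boot all_order all_algebra finmap.
From mathcomp Require Import monalg.

Set Implicit Arguments.
Unset Strict Implicit.
Unset Printing Implicit Defensive.

Import GRing.Theory.

Local Open Scope ring_scope.

(* Vector spaces are presented with a basis: {malg k[B]} is the space freely  *)
(* spanned by B, and the tensor product of {malg k[A]} and {malg k[B]} is     *)
(* {malg k[A * B]}, the pair (a, b) standing for the pure tensor of a and b.  *)

Section LinearExtension.

Variables (k : fieldType) (B : choiceType) (V : lmodType k) (f : B -> V).

Definition lext (x : {malg k[B]}) : V := \sum_(b <- msupp x) x@_b *: f b.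

Lemma lextEw (d : {fset B}) (x : {malg k[B]}) :
  (msupp x `<=` d)%fset -> lext x = \sum_(b <- d) x@_b *: f b.
Proof.
move=> le; apply: big_fset_incl => // b _ /mcoeff_outdom ->.
by rewrite scale0r.
Qed.

Lemma lext_is_linear : linear lext.
Proof.
move=> c x y; pose d := (msupp x `|` msupp y `|` msupp (c *: x + y))%fset.
have dz : (msupp (c *: x + y) `<=` d)%fset by rewrite fsubsetUr.
have dx : (msupp x `<=` d)%fset by rewrite /d -fsetUA fsubsetUl.
have dy : (msupp y `<=` d)%fset by rewrite /d -fsetUA fsetUCA fsubsetUl.
rewrite (lextEw dx) (lextEw dy) (lextEw dz).
rewrite scaler_sumr -big_split /=; apply: eq_bigr => b _.
by rewrite mcoeffD mcoeffZ scalerDl scalerA.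
Qed.

HB.instance Definition _ :=
  GRing.isLinear.Build k {malg k[B]} V _ lext lext_is_linear.

Lemma lextU (b : B) : lext << b >> = f b.
Proof. by rewrite /lext msuppU oner_eq0 big_seq_fset1 mcoeffUU scale1r. Qed.

End LinearExtension.

Lemma eq_lext (k : fieldType) (B : choiceType) (V : lmodType k)
  (f g : B -> V) : f =1 g -> lext f =1 lext g.
Proof. by move=> fg x; apply: eq_bigr => b _; rewrite fg. Qed.

Lemma linear_basisE (k : fieldType) (B : choiceType) (V : lmodType k)
  (f : {linear {malg k[B]} -> V}) : f =1 lext (fun b => f << b >>).
Proof.
move=> x; rewrite {1}(monalgE x) linear_sum; apply: eq_bigr => b _.
rewrite -linearZ; congr (f _); apply/malgP => c.
by rewrite mcoeffZ !mcoeffU mulrnAr mulr1.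
Qed.

Lemma linear_basisP (k : fieldType) (B : choiceType) (V : lmodType k)
  (f g : {linear {malg k[B]} -> V}) :
  (forall b, f << b >> = g << b >>) -> f =1 g.
Proof.
by move=> fg x; rewrite (linear_basisE f) (linear_basisE g); apply: eq_lext.
Qed.

Definition tens (k : fieldType) (A B : choiceType)
    (x : {malg k[A]}) (y : {malg k[B]}) : {malg k[(A * B)%type]} :=
  lext (fun a => lext (fun b => << (a, b) >>) y) x.

Notation "x \ox y" := (tens x y) (at level 40, left associativity).

Lemma tensUU (k : fieldType) (A B : choiceType) (a : A) (b : B) :
  << a >> \ox << b >> = << (a, b) >> :> {malg k[(A * B)%type]}.
Proof. by rewrite /tens !lextU. Qed.

Section Sweedler.

Variables (k : fieldType) (B : choiceType) (V : lmodType k).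
Variable d : {malg k[B]} -> {malg k[(B * B)%type]}.

Local Notation H := {malg k[B]}.

(* For F linear in each argument, sweedlern F a is F(a_1, ..., a_n) in        *)
(* Sweedler notation for the comultiplication d; the iterates are obtained by *)
(* applying d to the rightmost factor.                                        *)
Definition sweedler2 (F : H -> H -> V) (a : H) : V :=
  lext (fun p : B * B => F << p.1 >> << p.2 >>) (d a).
Definition sweedler3 (F : H -> H -> H -> V) : H -> V :=
  sweedler2 (fun a1 => sweedler2 (F a1)).
Definition sweedler4 (F : H -> H -> H -> H -> V) : H -> V :=
  sweedler2 (fun a1 => sweedler3 (F a1)).
Definition sweedler5 (F : H -> H -> H -> H -> H -> V) : H -> V :=
  sweedler2 (fun a1 => sweedler4 (F a1)).

End Sweedler.

Notation "\sw[ d ]_ ( a1 , a2 <- a ) E" :=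
  (sweedler2 d (fun a1 a2 => E) a)
  (at level 41, E at level 41, a1 name, a2 name, d, a at level 200,
   format "'[' \sw[ d ]_ ( a1 ,  a2  <-  a ) '/  '  E ']'").
Notation "\sw[ d ]_ ( a1 , a2 , a3 <- a ) E" :=
  (sweedler3 d (fun a1 a2 a3 => E) a)
  (at level 41, E at level 41, a1 name, a2 name, a3 name, d, a at level 200,
   format "'[' \sw[ d ]_ ( a1 ,  a2 ,  a3  <-  a ) '/  '  E ']'").
Notation "\sw[ d ]_ ( a1 , a2 , a3 , a4 <- a ) E" :=
  (sweedler4 d (fun a1 a2 a3 a4 => E) a)
  (at level 41, E at level 41, a1 name, a2 name, a3 name, a4 name, d, a at level 200,
   format "'[' \sw[ d ]_ ( a1 ,  a2 ,  a3 ,  a4  <-  a ) '/  '  E ']'").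
Notation "\sw[ d ]_ ( a1 , a2 , a3 , a4 , a5 <- a ) E" :=
  (sweedler5 d (fun a1 a2 a3 a4 a5 => E) a)
  (at level 41, E at level 41, a1 name, a2 name, a3 name, a4 name, a5 name, d, a at level 200,
   format "'[' \sw[ d ]_ ( a1 ,  a2 ,  a3 ,  a4 ,  a5  <-  a ) '/  '  E ']'").

Record coalgebra (k : fieldType) := Coalgebra {
  cobasis : choiceType;
  comul : {linear {malg k[cobasis]} -> {malg k[(cobasis * cobasis)%type]}};
  counit : {linear {malg k[cobasis]} -> k^o};
  coassoc : forall a,
    \sw[comul]_(x, a3 <- a) \sw[comul]_(a1, a2 <- x) (a1 \ox a2 \ox a3)
    = \sw[comul]_(a1, x <- a) \sw[comul]_(a2, a3 <- x) (a1 \ox a2 \ox a3);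
  counitl : forall a, \sw[comul]_(a1, a2 <- a) (counit a1 *: a2) = a;
  counitr : forall a, \sw[comul]_(a1, a2 <- a) (counit a2 *: a1) = a
}.

Section MajidAxioms.

Variables (k : fieldType) (C : coalgebra k).

Local Notation H := {malg k[cobasis C]}.
Local Notation HH := {malg k[(cobasis C * cobasis C)%type]}.
Local Notation HHH := {malg k[(cobasis C * cobasis C * cobasis C)%type]}.

Local Notation Delta := (comul C).
Local Notation eps := (counit C).
Local Notation "\sw_ ( a1 , a2 <- a ) E" := (\sw[Delta]_(a1, a2 <- a) E)
  (at level 41, E at level 41, a1 name, a2 name, a at level 200).
Local Notation "\sw_ ( a1 , a2 , a3 <- a ) E" :=
  (\sw[Delta]_(a1, a2, a3 <- a) E)
  (at level 41, E at level 41, a1 name, a2 name, a3 name, a at level 200).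
Local Notation "\sw_ ( a1 , a2 , a3 , a4 <- a ) E" :=
  (\sw[Delta]_(a1, a2, a3, a4 <- a) E)
  (at level 41, E at level 41, a1 name, a2 name, a3 name, a4 name, a at level 200).
Local Notation "\sw_ ( a1 , a2 , a3 , a4 , a5 <- a ) E" :=
  (\sw[Delta]_(a1, a2, a3, a4, a5 <- a) E)
  (at level 41, E at level 41, a1 name, a2 name, a3 name, a4 name, a5 name, a at level 200).

Variables (mul : {linear HH -> H}) (one : H).
Variables (phi phiV : {linear HHH -> k^o}).

Local Notation "a \m b" := (mul (a \ox b)) (at level 40, left associativity).
Local Notation "\Phi( a , b , c )" := (phi (a \ox b \ox c)).
Local Notation "\PhiV( a , b , c )" := (phiV (a \ox b \ox c)).

Definition mul_coalgebra_morphism : Prop :=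
  (forall a b : H, Delta (a \m b) =
     \sw_(a1, a2 <- a) \sw_(b1, b2 <- b) ((a1 \m b1) \ox (a2 \m b2)))
  /\ (forall a b : H, eps (a \m b) = eps a * eps b).

Definition unit_coalgebra_morphism : Prop :=
  Delta one = one \ox one /\ eps one = 1.

Definition unital : Prop := forall a : H, one \m a = a /\ a \m one = a.

Definition assoc_invertible : Prop :=
  forall a b c : H,
    \sw_(a1, a2 <- a) \sw_(b1, b2 <- b) \sw_(c1, c2 <- c)
      (\Phi(a1, b1, c1) * \PhiV(a2, b2, c2)) = eps a * eps b * eps c
    /\ \sw_(a1, a2 <- a) \sw_(b1, b2 <- b) \sw_(c1, c2 <- c)
      (\PhiV(a1, b1, c1) * \Phi(a2, b2, c2)) = eps a * eps b * eps c.

Definition quasi_associative : Prop :=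
  forall a b c : H,
    \sw_(a1, a2 <- a) \sw_(b1, b2 <- b) \sw_(c1, c2 <- c)
      (\Phi(a2, b2, c2) *: (a1 \m (b1 \m c1)))
    = \sw_(a1, a2 <- a) \sw_(b1, b2 <- b) \sw_(c1, c2 <- c)
      (\Phi(a1, b1, c1) *: ((a2 \m b2) \m c2)).

Definition pentagon : Prop :=
  forall a b c d : H,
    \sw_(a1, a2 <- a) \sw_(b1, b2 <- b)
    \sw_(c1, c2 <- c) \sw_(d1, d2 <- d)
      (\Phi(a1, b1, c1 \m d1) * \Phi(a2 \m b2, c2, d2))
    = \sw_(a1, a2 <- a) \sw_(b1, b2, b3 <- b)
      \sw_(c1, c2, c3 <- c) \sw_(d1, d2 <- d)
      (\Phi(b1, c1, d1) * \Phi(a1, b2 \m c2, d2) * \Phi(a2, b3, c3)).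

Definition assoc_normalized : Prop :=
  forall a b : H, \Phi(a, one, b) = eps a * eps b.

Definition coalgebra_antimorphism (S : {linear H -> H}) : Prop :=
  (forall a : H, Delta (S a) = \sw_(a1, a2 <- a) (S a2 \ox S a1))
  /\ (forall a : H, eps (S a) = eps a).

Definition quasi_antipode (S : {linear H -> H})
    (alpha beta : {linear H -> k^o}) : Prop :=
  [/\ coalgebra_antimorphism S,
      forall a : H,
        \sw_(a1, a2, a3 <- a) (alpha a2 *: (S a1 \m a3)) = alpha a *: one,
      forall a : H,
        \sw_(a1, a2, a3 <- a) (beta a2 *: (a1 \m S a3)) = beta a *: one,
      forall a : H,
        \sw_(a1, a2, a3, a4, a5 <- a)
          (\Phi(a1, S a3, a5) * beta a2 * alpha a4) = eps a
    & forall a : H,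
        \sw_(a1, a2, a3, a4, a5 <- a)
          (\PhiV(S a1, a3, S a5) * alpha a2 * beta a4) = eps a].

Variables (r rV : {linear HH -> k^o}).

Local Notation "\R( a , b )" := (r (a \ox b)).
Local Notation "\RV( a , b )" := (rV (a \ox b)).

Definition braiding_invertible : Prop :=
  forall a b : H,
    \sw_(a1, a2 <- a) \sw_(b1, b2 <- b) (\R(a1, b1) * \RV(a2, b2))
      = eps a * eps b
    /\ \sw_(a1, a2 <- a) \sw_(b1, b2 <- b) (\RV(a1, b1) * \R(a2, b2))
      = eps a * eps b.

Definition hexagonl : Prop :=
  forall a b c : H,
    \R(a \m b, c) =
    \sw_(a1, a2, a3, a4 <- a) \sw_(b1, b2, b3, b4 <- b)
    \sw_(c1, c2, c3, c4, c5 <- c)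
      (\Phi(c1, a1, b1) * \R(a2, c2) * \PhiV(a3, c3, b2) * \R(b3, c4)
       * \Phi(a4, b4, c5)).

Definition hexagonr : Prop :=
  forall a b c : H,
    \R(a, b \m c) =
    \sw_(a1, a2, a3, a4, a5 <- a) \sw_(b1, b2, b3, b4 <- b)
    \sw_(c1, c2, c3, c4 <- c)
      (\PhiV(b1, c1, a1) * \R(a2, c2) * \Phi(b2, a3, c3) * \R(a4, b3)
       * \PhiV(a5, b4, c4)).

Definition braided_commutative : Prop :=
  forall a b : H,
    \sw_(a1, a2 <- a) \sw_(b1, b2 <- b) (\R(a2, b2) *: (b1 \m a1))
    = \sw_(a1, a2 <- a) \sw_(b1, b2 <- b) (\R(a1, b1) *: (a2 \m b2)).

End MajidAxioms.

(* The unit k -> H is given by the image of 1, and convolution inverses,      *)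
(* being unique, are recorded as data.                                        *)
Record majid_algebra (k : fieldType) (C : coalgebra k) := MajidAlgebra {
  mj_mul :
    {linear {malg k[(cobasis C * cobasis C)%type]} -> {malg k[cobasis C]}};
  mj_one : {malg k[cobasis C]};
  mj_phi :
    {linear {malg k[(cobasis C * cobasis C * cobasis C)%type]} -> k^o};
  mj_phiV :
    {linear {malg k[(cobasis C * cobasis C * cobasis C)%type]} -> k^o};
  mj_mulP : mul_coalgebra_morphism mj_mul;
  mj_oneP : unit_coalgebra_morphism mj_one;
  mj_unital : unital mj_mul mj_one;
  mj_phi_inv : assoc_invertible mj_phi mj_phiV;
  mj_mulqA : quasi_associative mj_mul mj_phi;
  mj_pentagon : pentagon mj_mul mj_phi;
  mj_phi1 : assoc_normalized mj_one mj_phi;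
  mj_antipodeP : exists S alpha beta,
    quasi_antipode mj_mul mj_one mj_phi mj_phiV S alpha beta
}.

Record coquasitriangular (k : fieldType) (C : coalgebra k)
    (M : majid_algebra C) := Coquasitriangular {
  cq_r : {linear {malg k[(cobasis C * cobasis C)%type]} -> k^o};
  cq_rV : {linear {malg k[(cobasis C * cobasis C)%type]} -> k^o};
  cq_inv : braiding_invertible cq_r cq_rV;
  cq_hexl : hexagonl (mj_mul M) (mj_phi M) (mj_phiV M) cq_r;
  cq_hexr : hexagonr (mj_mul M) (mj_phi M) (mj_phiV M) cq_r;
  cq_comm : braided_commutative (mj_mul M) cq_r
}.

Definition admits_coquasitriangular_majid (k : fieldType) (C : coalgebra k) :
  Prop := exists M : majid_algebra C, inhabited (coquasitriangular M).

Record quiver := Quiver {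
  vertex : choiceType;
  arrow : choiceType;
  src : arrow -> vertex;
  tgt : arrow -> vertex
}.

(* Only finitely many arrows join two given vertices: the multiplicities of   *)
(* the arrows of a Hopf quiver are natural numbers.                           *)
Definition finite_multiplicities (Q : quiver) : Prop :=
  forall x y : vertex Q, exists s : seq (arrow Q),
    forall a : arrow Q, src a = x -> tgt a = y -> a \in s.

Record quiver_iso (Q Q' : quiver) := QuiverIso {
  iso_vertex : vertex Q -> vertex Q';
  iso_arrow : arrow Q -> arrow Q';
  iso_vertex_bij : bijective iso_vertex;
  iso_arrow_bij : bijective iso_arrow;
  iso_src : forall a, src (iso_arrow a) = iso_vertex (src a);
  iso_tgt : forall a, tgt (iso_arrow a) = iso_vertex (tgt a)
}.

Section Paths.

Variable Q : quiver.

(* The path a_l ... a_1 is the pair of its source and of the list             *)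
(* [:: a_1; ...; a_l]; (x, [::]) is the vertex x.                             *)
Fixpoint composable (x : vertex Q) (w : seq (arrow Q)) : bool :=
  if w is a :: w' then (src a == x) && composable (tgt a) w' else true.

Definition endpoint (x : vertex Q) (w : seq (arrow Q)) : vertex Q :=
  last x (map (@tgt Q) w).

Definition qpath :=
  {p : (vertex Q * seq (arrow Q))%type | composable p.1 p.2}.

Definition qstart (p : qpath) : vertex Q := (val p).1.
Definition qarrows (p : qpath) : seq (arrow Q) := (val p).2.
Definition qlength (p : qpath) : nat := size (qarrows p).

Lemma composable_take i x w : composable x w -> composable x (take i w).
Proof.
by elim: w x i => [|a w IH] x [|i] //= /andP[-> /IH->].
Qed.

Lemma composable_drop i x w :
  composable x w -> composable (endpoint x (take i w)) (drop i w).
Proof.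
by rewrite /endpoint; elim: w x i => [|a w IH] x [|i] //= /andP[_ /IH].
Qed.

Definition qtake (i : nat) (p : qpath) : qpath :=
  exist _ (qstart p, take i (qarrows p)) (composable_take i (valP p)).

Definition qdrop (i : nat) (p : qpath) : qpath :=
  exist _ (endpoint (qstart p) (take i (qarrows p)), drop i (qarrows p))
    (composable_drop i (valP p)).

Lemma qdrop_qdrop i j p : qdrop j (qdrop i p) = qdrop (i + j) p.
Proof.
apply: val_inj; rewrite /= /qarrows /qstart /= drop_drop addnC.
by rewrite /endpoint takeD map_cat last_cat.
Qed.

Lemma qtake_qtake i j p : (i <= j)%N -> qtake i (qtake j p) = qtake i p.
Proof. by move=> ij; apply: val_inj; rewrite /= /qarrows /= take_takel. Qed.

Lemma qtake_qdrop i j p : qtake j (qdrop i p) = qdrop i (qtake (i + j) p).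
Proof.
apply: val_inj; rewrite /= /qarrows /qstart /= take_drop addnC.
by rewrite take_takel // (leq_addr, leq_addl).
Qed.

Lemma qlength_qdrop i p : qlength (qdrop i p) = (qlength p - i)%N.
Proof. by rewrite /qlength size_drop. Qed.

Lemma qlength_qtake i p : (i <= qlength p)%N -> qlength (qtake i p) = i.
Proof. by rewrite /qlength => le; rewrite size_takel. Qed.

Lemma qtake_all p : qtake (qlength p) p = p.
Proof. by apply: val_inj; rewrite /= take_size -surjective_pairing. Qed.

Lemma qdrop0 p : qdrop 0 p = p.
Proof.
by apply: val_inj; rewrite /= take0 drop0 -surjective_pairing.
Qed.

End Paths.

Lemma sum_triangle (V : zmodType) (n : nat) (F : nat -> nat -> V) :
  \sum_(i < n.+1) \sum_(j < (n - i).+1) F i (i + j)%N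
  = \sum_(j < n.+1) \sum_(i < j.+1) F i j.
Proof.
transitivity (\sum_(i < n.+1) \sum_(j < n.+1 | (i <= j)%N) F i j).
  apply: eq_bigr => i _; rewrite -(big_geq_mkord _ _ (fun=> true)).
  rewrite -[X in \sum_(X <= _ < _) _]add0n big_addn big_mkord subSn -1?ltnS //.
  by apply: eq_bigr => j _; rewrite addnC.
rewrite (exchange_big_dep xpredT) //=; apply: eq_bigr => j _.
by rewrite (big_ord_widen n.+1 (fun i => F i j)).
Qed.

Section PathCoalgebra.

Variables (k : fieldType) (Q : quiver).

Local Notation H := {malg k[qpath Q]}.

(* The terms i = 0 and i = l of the comultiplication of a_l ... a_1 are       *)
(* a_l ... a_1 (x) s(a_1) and t(a_l) (x) a_l ... a_1.                         *)
Definition path_comul : {linear H -> {malg k[(qpath Q * qpath Q)%type]}} :=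
  lext (fun p : qpath Q =>
    \sum_(i < (qlength p).+1) << (qdrop i p, qtake i p) >>).

Definition path_counit : {linear H -> k^o} :=
  lext (fun p : qpath Q => (qlength p == 0%N)%:R : k^o).

Lemma path_comulU (p : qpath Q) :
  path_comul << p >> = \sum_(i < (qlength p).+1) << (qdrop i p, qtake i p) >>.
Proof. exact: lextU. Qed.

Lemma path_counitU (p : qpath Q) : path_counit << p >> = (qlength p == 0%N)%:R.
Proof. exact: lextU. Qed.

Lemma sweedler2_path (V : lmodType k) (F : H -> H -> V) (p : qpath Q) :
  \sw[path_comul]_(a1, a2 <- << p >>) F a1 a2
  = \sum_(i < (qlength p).+1) F << qdrop i p >> << qtake i p >>.
Proof.
rewrite /sweedler2 path_comulU linear_sum; apply: eq_bigr => i _.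
exact: lextU.
Qed.

Lemma sweedler2_eq (V : lmodType k) (F G : H -> H -> V) :
  (forall p, \sw[path_comul]_(a1, a2 <- << p >>) F a1 a2
             = \sw[path_comul]_(a1, a2 <- << p >>) G a1 a2) ->
  sweedler2 path_comul F =1 sweedler2 path_comul G.
Proof.
move=> FG; exact: (linear_basisP
  (f := lext (fun p : qpath Q * qpath Q => F << p.1 >> << p.2 >>)
        \o path_comul)
  (g := lext (fun p : qpath Q * qpath Q => G << p.1 >> << p.2 >>)
        \o path_comul)).
Qed.

Lemma path_coassoc (a : H) :
  \sw[path_comul]_(x, a3 <- a) \sw[path_comul]_(a1, a2 <- x)
    (a1 \ox a2 \ox a3)
  = \sw[path_comul]_(a1, x <- a) \sw[path_comul]_(a2, a3 <- x)
    (a1 \ox a2 \ox a3).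
Proof.
move: a; apply: sweedler2_eq => p; rewrite [LHS]sweedler2_path.
rewrite [RHS]sweedler2_path.
pose F i j : {malg k[(qpath Q * qpath Q * qpath Q)%type]} :=
  << qdrop j p >> \ox << qdrop i (qtake j p) >> \ox << qtake i p >>.
transitivity (\sum_(i < (qlength p).+1)
                \sum_(j < (qlength p - i).+1) F i (i + j)%N).
  apply: eq_bigr => i _; rewrite [LHS]sweedler2_path qlength_qdrop.
  by apply: eq_bigr => j _; rewrite /F qdrop_qdrop qtake_qdrop.
rewrite sum_triangle; apply: eq_bigr => j _.
have le_j : (j <= qlength p)%N by rewrite -ltnS.
rewrite [RHS]sweedler2_path (qlength_qtake le_j); apply: eq_bigr => i _.
have le_i : (i <= j)%N by rewrite -ltnS.
by rewrite /F (qtake_qtake _ le_i).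
Qed.

Lemma path_counitl (a : H) :
  \sw[path_comul]_(a1, a2 <- a) (path_counit a1 *: a2) = a.
Proof.
apply: (linear_basisP (g := idfun)
  (f := lext (fun p : qpath Q * qpath Q =>
          path_counit << p.1 >> *: << p.2 >>) \o path_comul)) => p.
apply: etrans (sweedler2_path (fun a b => path_counit a *: b) p) _.
rewrite big_ord_recr big1 /= => [|i _].
  by rewrite add0r path_counitU qlength_qdrop subnn eqxx scale1r qtake_all.
by rewrite path_counitU qlength_qdrop subn_eq0 leqNgt ltn_ord scale0r.
Qed.

Lemma path_counitr (a : H) :
  \sw[path_comul]_(a1, a2 <- a) (path_counit a2 *: a1) = a.
Proof.
apply: (linear_basisP (g := idfun)
  (f := lext (fun p : qpath Q * qpath Q =>
          path_counit << p.2 >> *: << p.1 >>) \o path_comul)) => p.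
apply: etrans (sweedler2_path (fun a b => path_counit b *: a) p) _.
rewrite big_ord_recl big1 /= => [|i _].
  by rewrite addr0 path_counitU qlength_qtake // eqxx scale1r qdrop0.
by rewrite path_counitU qlength_qtake ?ltn_ord //= scale0r.
Qed.

Definition path_coalgebra : coalgebra k :=
  Coalgebra path_coassoc path_counitl path_counitr.

End PathCoalgebra.

(* A formal sum of conjugacy classes is the function giving, at each element, *)
(* the coefficient of its class.                                              *)
Record ramification (G : groupType) := Ramification {
  ram :> G -> nat;
  ramJ : forall x g : G, ram (x ^ g)%g = ram x
}.

(* (x, Tagged c i) is the i-th arrow from x to c * x. *)
Definition hopf_quiver (G : groupType) (R : ramification G) : quiver :=
  @Quiver G (G * {c : G & 'I_(R c)})%type
    (fun a => a.1) (fun a => (tag a.2 * a.1)%g).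

(* Main.v *)
Require Import Defs.
From HB Require Import structures.
From mathcomp Require Import all_boot all_order all_algebra finmap monalg.
From mathcomp Require Import ring.
From mathcomp Require Import zify.
From Stdlib Require Import IndefiniteDescription.

Set Implicit Arguments.
Unset Strict Implicit.
Unset Printing Implicit Defensive.

Import GRing.Theory.
Local Open Scope ring_scope.

(** Suppose that kQ carries a coquasitriangular Majid structure.  Its
    group-like elements are the vertices ([grouplike_vertex]), and on
    group-like elements all Sweedler sums have one term: the axioms become
    Phi(x,y,z) x(yz) = Phi(x,y,z) (xy)z and R(x,y) yx = R(x,y) xy with
    invertible scalars, and the quasi-antipode provides inverses.  So the
    vertices form an abelian group G ([exists_vertex_group]).  An arrow a from
    x to y is skew-primitive: its comultiplication is y (x) a + a (x) x.
    Then a z is skew-primitive from xz to yz, hence a combination of arrows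
    from xz to yz and of vertices ([skew_primitive_support]), and
    quasi-associativity shows that (a z) z^-1 is a nonzero multiple of a modulo
    vertices ([skew_primitive_mulK]).  Right multiplication by z is therefore
    injective on arrows modulo vertices, which gives
    #(x -> y) <= #(xz -> yz) for all x, y, z ([leq_arrow_count]) and,
    translating back, equality: the number of arrows from x to cx depends on c
    alone, and Q is the Hopf quiver with these multiplicities
    ([exists_hopf_quiver_iso]).

    Conversely let G be abelian.  A path of Q(G,R) is a starting vertex x
    together with a word w of labels, and the shuffle product
    (x, u) (y, v) = sum of the (xy, w), w an interleaving of u and v,
    is a commutative Hopf algebra structure on the path coalgebra, over any
    field ([shuffle_coquasitriangular]).  It is a coquasitriangular Majid
    algebra for the trivial associator and the trivial braiding
    ([commutative_hopf_coquasitriangular]).  Commutativity of G enters because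
    the endpoint of an interleaving has to be the product of the endpoints. *)

(** * Linear extension from a basis *)

Section Linearity.

Variable k : fieldType.

Lemma linear_comp (U V W : lmodType k) (f : {linear V -> W}) (g : U -> V) :
  linear g -> linear (fun x => f (g x)).
Proof. by move=> lg c x y; rewrite lg linearP. Qed.

Lemma linear_idP (U : lmodType k) : linear (fun x : U => x).
Proof. by []. Qed.

Lemma linear_tensl (U : lmodType k) (A B : choiceType)
    (f : U -> {malg k[A]}) (y : {malg k[B]}) :
  linear f -> linear (fun x => f x \ox y).
Proof. by move=> lf c x x'; rewrite lf /tens linearP. Qed.

Lemma linear_tensr (U : lmodType k) (A B : choiceType)
    (x : {malg k[A]}) (g : U -> {malg k[B]}) :
  linear g -> linear (fun y => x \ox g y).
Proof.
move=> lg c y y'; rewrite lg /tens /lext scaler_sumr -big_split /=.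
apply: eq_bigr => a _; rewrite -/(lext _ _) linearP scalerDr.
by rewrite !scalerA mulrC.
Qed.

Lemma linear_scale (U V : lmodType k) (c : k) (f : U -> V) :
  linear f -> linear (fun x => c *: f x).
Proof.
by move=> lf e x y; rewrite lf scalerDr !scalerA mulrC.
Qed.

Lemma linear_scalel (U V : lmodType k) (f : U -> k^o) (v : V) :
  linear f -> linear (fun x => (f x : k) *: v).
Proof. by move=> lf e x y; rewrite lf scalerDl scalerA. Qed.

Lemma linear_mull (U : lmodType k) (f : U -> k^o) (c : k) :
  linear f -> linear (fun x => (f x : k) * c : k^o).
Proof. exact: (@linear_scalel U k^o). Qed.

Lemma linear_mulr (U : lmodType k) (f : U -> k^o) (c : k) :
  linear f -> linear (fun x => c * (f x : k) : k^o).
Proof. exact: (@linear_scale U k^o). Qed.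

(** [sweedler2] evaluates [F] at basis vectors and extends linearly. *)
Lemma linear_sweedler2 (B : choiceType) (V : lmodType k)
  (d : {linear {malg k[B]} -> {malg k[(B * B)%type]}})
  (F : {malg k[B]} -> {malg k[B]} -> V) : linear (sweedler2 d F).
Proof. by move=> c x y; rewrite /sweedler2 !linearP. Qed.

Lemma linear_under_sweedler2 (B : choiceType) (U V : lmodType k)
  (d : {malg k[B]} -> {malg k[(B * B)%type]})
  (F : U -> {malg k[B]} -> {malg k[B]} -> V) (a : {malg k[B]}) :
  (forall a1 a2, linear (fun x => F x a1 a2)) ->
  linear (fun x => sweedler2 d (F x) a).
Proof.
move=> lF c x y; rewrite /sweedler2 /lext scaler_sumr -big_split /=.
by apply: eq_bigr => p _; rewrite lF scalerDr !scalerA mulrC.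
Qed.

Lemma linearZ_of (U V : lmodType k) (f : U -> V) (c : k) (u : U) :
  linear f -> f (c *: u) = c *: f u.
Proof.
move=> lf.
pose f' := HB.pack_for {linear U -> V} f
  (GRing.isLinear.Build _ _ _ _ f lf).
exact: (linearZ_LR f').
Qed.

(** Linearity is kept as an unbundled predicate, so that identities between
    nested Sweedler sums are reduced to basis vectors one variable at a time,
    each map involved being left implicit. *)
Lemma linear_ext (B : choiceType) (V : lmodType k) (f g : {malg k[B]} -> V) :
  linear f -> linear g -> (forall b, f << b >> = g << b >>) -> f =1 g.
Proof.
move=> lf lg fg.
pose f' := HB.pack_for {linear {malg k[B]} -> V} f
  (GRing.isLinear.Build _ _ _ _ f lf).
pose g' := HB.pack_for {linear {malg k[B]} -> V} g
  (GRing.isLinear.Build _ _ _ _ g lg).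
exact: (@linear_basisP _ _ _ f' g').
Qed.

Lemma bilinear_ext (A B : choiceType) (V : lmodType k)
    (f g : {malg k[A]} -> {malg k[B]} -> V) :
  (forall y, linear (f^~ y)) -> (forall x, linear (f x)) ->
  (forall y, linear (g^~ y)) -> (forall x, linear (g x)) ->
  (forall a b, f << a >> << b >> = g << a >> << b >>) -> f =2 g.
Proof.
move=> fl fr gl gr fg x y; move: x; apply: linear_ext => // a.
by move: y; apply: linear_ext => // b.
Qed.

End Linearity.

Lemma eq_sweedler2 (k : fieldType) (B : choiceType) (V : lmodType k)
    (d : {malg k[B]} -> {malg k[(B * B)%type]})
    (F G : {malg k[B]} -> {malg k[B]} -> V) :
  (forall x y, F x y = G x y) -> sweedler2 d F =1 sweedler2 d G.
Proof. by move=> FG a; apply: eq_lext => p; rewrite FG. Qed.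

(** * Trivial associator and trivial braiding *)

Section CounitCollapse.

Variables (k : fieldType) (C : coalgebra k).
Local Notation H := {malg k[cobasis C]}.
Local Notation d := (comul C).
Local Notation eps := (counit C).

(** The counit law under a linear map [G]: it removes the Sweedler legs that
    occur only in the counit. *)
Lemma sweedler2_counitr (V : lmodType k) (F : H -> H -> V) (G : H -> V) a :
  linear G -> (forall a1 a2, F a1 a2 = (eps a2 : k) *: G a1) ->
  sweedler2 d F a = G a.
Proof.
move=> lG FG; rewrite -[in RHS](counitr a) (eq_sweedler2 _ FG) /sweedler2.
move: (d a) => {a} x; move: x; apply: linear_ext => [|u v w|p].
- by move=> u v w; rewrite linearP.
- by rewrite linearP lG.
- by rewrite !lextU; exact/esym/linearZ_of.
Qed.

Lemma sweedler2_counitl (V : lmodType k) (F : H -> H -> V) (G : H -> V) a :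
  linear G -> (forall a1 a2, F a1 a2 = (eps a1 : k) *: G a2) ->
  sweedler2 d F a = G a.
Proof.
move=> lG FG; rewrite -[in RHS](counitl a) (eq_sweedler2 _ FG) /sweedler2.
move: (d a) => {a} x; move: x; apply: linear_ext => [|u v w|p].
- by move=> u v w; rewrite linearP.
- by rewrite linearP lG.
- by rewrite !lextU; exact/esym/linearZ_of.
Qed.

(** In an identity of scalars all legs occur in counits only; [c] gathers the
    factors that do not come from [a]. *)
Lemma sweedler2_eps (F : H -> H -> k^o) (c x : k) a :
  (forall a1 a2, F a1 a2 = c * (eps a1 * eps a2)) -> c * eps a = x ->
  sweedler2 d F a = x.
Proof.
move=> FG <-.
apply: (sweedler2_counitr (G := fun x => c * eps x : k^o)) => [|a1 a2].
  by apply: linear_mulr; apply: linear_comp; apply: linear_idP.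
by rewrite FG mulrA mulrC.
Qed.

Lemma sweedler3_eps (F : H -> H -> H -> k^o) (c x : k) a :
  (forall a1 a2 a3, F a1 a2 a3 = c * (eps a1 * eps a2 * eps a3)) ->
  c * eps a = x -> sweedler3 d F a = x.
Proof.
move=> FG; apply: sweedler2_eps => a1 a2; rewrite mulrA.
by apply: sweedler2_eps _ _ (erefl _) => *; rewrite FG !mulrA.
Qed.

Lemma sweedler4_eps (F : H -> H -> H -> H -> k^o) (c x : k) a :
  (forall a1 a2 a3 a4, 
     F a1 a2 a3 a4 = c * (eps a1 * eps a2 * eps a3 * eps a4)) ->
  c * eps a = x -> sweedler4 d F a = x.
Proof.
move=> FG; apply: sweedler2_eps => a1 a2; rewrite mulrA.
by apply: sweedler3_eps _ _ (erefl _) => *; rewrite FG !mulrA.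
Qed.

Lemma sweedler5_eps (F : H -> H -> H -> H -> H -> k^o) (c x : k) a :
  (forall a1 a2 a3 a4 a5, 
     F a1 a2 a3 a4 a5 = c * (eps a1 * eps a2 * eps a3 * eps a4 * eps a5)) ->
  c * eps a = x -> sweedler5 d F a = x.
Proof.
move=> FG; apply: sweedler2_eps => a1 a2; rewrite mulrA.
by apply: sweedler4_eps _ _ (erefl _) => *; rewrite FG !mulrA.
Qed.

Definition trivial_associator :
  {linear {malg k[(cobasis C * cobasis C * cobasis C)%type]} -> k^o} :=
  lext (fun p => eps << p.1.1 >> * eps << p.1.2 >> * eps << p.2 >> : k^o).

Definition trivial_braiding :
  {linear {malg k[(cobasis C * cobasis C)%type]} -> k^o} :=
  lext (fun p => eps << p.1 >> * eps << p.2 >> : k^o).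

Lemma trivial_braidingE a b : trivial_braiding (a \ox b) = eps a * eps b.
Proof.
move: a b; apply: bilinear_ext => [y|x|y|x|a b].
- by apply: linear_comp; apply: linear_tensl.
- by apply: linear_comp; apply: linear_tensr.
- by apply: linear_mull; apply: linear_comp.
- by apply: linear_mulr; apply: linear_comp.
by rewrite tensUU [LHS]lextU.
Qed.

Lemma trivial_associatorE a b c :
  trivial_associator (a \ox b \ox c) = eps a * eps b * eps c.
Proof.
move: a; apply: linear_ext.
- by apply: linear_comp; do 2!apply: linear_tensl.
- by do 2!apply: linear_mull; apply: linear_comp.
move=> a; move: b c; apply: bilinear_ext => [y|x|y|x|b c].
- by apply: linear_comp; apply: linear_tensl; apply: linear_tensr.
- by apply: linear_comp; apply: linear_tensr.
- by apply: linear_mull; apply: linear_mulr; apply: linear_comp.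
- by apply: linear_mulr; apply: linear_comp.
by rewrite !tensUU [LHS]lextU.
Qed.

End CounitCollapse.

Section CommutativeHopf.

Variables (k : fieldType) (C : coalgebra k).
Local Notation H := {malg k[cobasis C]}.
Local Notation d := (comul C).
Local Notation eps := (counit C).
Variables (mul : {linear {malg k[(cobasis C * cobasis C)%type]} -> H}).
Variables (one : H) (S : {linear H -> H}).
Local Notation "a \m b" := (mul (a \ox b)) (at level 40, left associativity).

Hypothesis mulP : mul_coalgebra_morphism mul.
Hypothesis oneP : unit_coalgebra_morphism one.
Hypothesis mul1 : unital mul one.
Hypothesis mulA : forall a b c, a \m (b \m c) = (a \m b) \m c.
Hypothesis mulC : forall a b, a \m b = b \m a.
Hypothesis SP : coalgebra_antimorphism S.
Hypothesis mulSl : forall a, \sw[d]_(a1, a2 <- a) (S a1 \m a2) = eps a *: one.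
Hypothesis mulSr : forall a, \sw[d]_(a1, a2 <- a) (a1 \m S a2) = eps a *: one.

Let eps_mul a b : eps (a \m b) = eps a * eps b. Proof. exact: mulP.2. Qed.
Let eps_S a : eps (S a) = eps a. Proof. exact: SP.2. Qed.
Variable phi :
  {linear {malg k[(cobasis C * cobasis C * cobasis C)%type]} -> k^o}.
Variable r : {linear {malg k[(cobasis C * cobasis C)%type]} -> k^o}.
Hypothesis phiE : forall a b c, phi (a \ox b \ox c) = eps a * eps b * eps c.
Hypothesis rE : forall a b, r (a \ox b) = eps a * eps b.

Lemma trivial_associator_invertible : assoc_invertible phi phi.
Proof.
suff E a b c : \sw[d]_(a1, a2 <- a) \sw[d]_(b1, b2 <- b) \sw[d]_(c1, c2 <- c)
    (phi (a1 \ox b1 \ox c1) * phi (a2 \ox b2 \ox c2) : k^o)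
    = eps a * eps b * eps c.
  by move=> a b c; split; apply: E.
apply: (sweedler2_eps (C := C) (c := eps b * eps c) _) => [a1 a2|];
  last by ring.
apply: (sweedler2_eps (C := C) (c := eps a1 * eps a2 * eps c) _)
  => [b1 b2|]; last by ring.
apply: (sweedler2_eps (C := C) (c := eps a1 * eps a2 * (eps b1 * eps b2)) _)
  => [c1 c2|]; last by ring.
rewrite -> !phiE; ring.
Qed.

Lemma trivial_pentagon : pentagon mul phi.
Proof.
move=> a b c e; transitivity (eps a * eps b * eps c * eps e).
  apply: (sweedler2_eps (C := C) (c := eps b * eps c * eps e) _) => [a1 a2|];
    last by ring.
  apply: (sweedler2_eps (C := C) (c := eps a1 * eps a2 * eps c * eps e) _)
    => [b1 b2|]; last by ring.
  apply: (sweedler2_eps (C := C)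
    (c := eps a1 * eps a2 * (eps b1 * eps b2) * eps e) _)
    => [c1 c2|]; last by ring.
  apply: (sweedler2_eps (C := C)
    (c := eps a1 * eps a2 * (eps b1 * eps b2) * (eps c1 * eps c2)) _)
    => [e1 e2|]; last by ring.
  rewrite -> !phiE, !eps_mul; ring.
apply/esym.
apply: (sweedler2_eps (C := C) (c := eps b * eps c * eps e) _) => [a1 a2|];
  last by ring.
apply: (sweedler3_eps (C := C) (c := eps a1 * eps a2 * eps c * eps e) _)
  => [b1 b2 b3|]; last by ring.
apply: (sweedler3_eps (C := C)
  (c := eps a1 * eps a2 * (eps b1 * eps b2 * eps b3) * eps e) _)
  => [c1 c2 c3|]; last by ring.
apply: (sweedler2_eps (C := C)
  (c := eps a1 * eps a2 * (eps b1 * eps b2 * eps b3)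
        * (eps c1 * eps c2 * eps c3)) _)
  => [e1 e2|]; last by ring.
rewrite -> !phiE, !eps_mul; ring.
Qed.

Lemma trivial_quasi_associative : quasi_associative mul phi.
Proof.
move=> a b c; transitivity (a \m (b \m c)).
  apply: (sweedler2_counitr (G := fun x => x \m (b \m c))) => [|a1 a2].
    by apply: linear_comp; apply: linear_tensl.
  apply: (sweedler2_counitr (G := fun x => eps a2 *: (a1 \m (x \m c))))
    => [|b1 b2].
    apply: linear_scale; apply: linear_comp; apply: linear_tensr.
    by apply: linear_comp; apply: linear_tensl.
  apply: (sweedler2_counitr
    (G := fun x => eps b2 *: (eps a2 *: (a1 \m (b1 \m x))))) => [|c1 c2].
    do 2!apply: linear_scale; apply: linear_comp; apply: linear_tensr.
    by apply: linear_comp; apply: linear_tensr.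
  by rewrite phiE !scalerA; congr (_ *: _); ring.
rewrite -> mulA; apply/esym.
apply: (sweedler2_counitl (G := fun x => (x \m b) \m c)) => [|a1 a2].
  by do 2!(apply: linear_comp; apply: linear_tensl).
apply: (sweedler2_counitl (G := fun x => eps a1 *: ((a2 \m x) \m c)))
  => [|b1 b2].
  apply: linear_scale; apply: linear_comp; apply: linear_tensl.
  by apply: linear_comp; apply: linear_tensr.
apply: (sweedler2_counitl
  (G := fun x => eps b1 *: (eps a1 *: ((a2 \m b2) \m x)))) => [|c1 c2].
  by do 2!apply: linear_scale; apply: linear_comp; apply: linear_tensr.
by rewrite phiE !scalerA; congr (_ *: _); ring.
Qed.

Lemma trivial_quasi_antipode : quasi_antipode mul one phi phi S eps eps.
Proof.
split=> // a.
- rewrite -mulSl; apply: eq_sweedler2 => a1 x.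
  apply: (sweedler2_counitl (G := fun x => S a1 \m x)) => //.
  by apply: linear_comp; apply: linear_tensr.
- rewrite -mulSr; apply: eq_sweedler2 => a1 x.
  apply: (sweedler2_counitl (G := fun x => a1 \m S x)) => //.
  by apply: linear_comp; apply: linear_tensr; apply: linear_comp.
- apply: (sweedler5_eps (C := C) (c := 1) _) => [*|]; last by rewrite mul1r.
  rewrite -> phiE, eps_S; ring.
- apply: (sweedler5_eps (C := C) (c := 1) _) => [*|]; last by rewrite mul1r.
  rewrite -> phiE, !eps_S; ring.
Qed.

Lemma trivial_braiding_invertible : braiding_invertible r r.
Proof.
suff E a b : \sw[d]_(a1, a2 <- a) \sw[d]_(b1, b2 <- b)
   (r (a1 \ox b1) * r (a2 \ox b2) : k^o) = eps a * eps b.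
  by move=> a b; split; apply: E.
apply: (sweedler2_eps (C := C) (c := eps b) _) => [a1 a2|]; last by ring.
apply: (sweedler2_eps (C := C) (c := eps a1 * eps a2) _) => [b1 b2|];
  last by ring.
rewrite -> !rE; ring.
Qed.

Lemma trivial_hexagonl : hexagonl mul phi phi r.
Proof.
move=> a b c; rewrite -> rE, eps_mul; apply/esym.
apply: (sweedler4_eps (C := C) (c := eps b * eps c) _) => [a1 a2 a3 a4|];
  last by ring.
apply: (sweedler4_eps (C := C)
  (c := eps a1 * eps a2 * eps a3 * eps a4 * eps c) _)
  => [b1 b2 b3 b4|]; last by ring.
apply: (sweedler5_eps (C := C) (c := eps a1 * eps a2 * eps a3 * eps a4
        * (eps b1 * eps b2 * eps b3 * eps b4)) _) => [c1 c2 c3 c4 c5|];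
  last by ring.
rewrite -> !phiE, !rE; ring.
Qed.

Lemma trivial_hexagonr : hexagonr mul phi phi r.
Proof.
move=> a b c; rewrite -> rE, eps_mul; apply/esym.
apply: (sweedler5_eps (C := C) (c := eps b * eps c) _) => [a1 a2 a3 a4 a5|];
  last by ring.
apply: (sweedler4_eps (C := C)
  (c := eps a1 * eps a2 * eps a3 * eps a4 * eps a5 * eps c) _)
  => [b1 b2 b3 b4|]; last by ring.
apply: (sweedler4_eps (C := C) (c := eps a1 * eps a2 * eps a3 * eps a4 * eps a5
        * (eps b1 * eps b2 * eps b3 * eps b4)) _) => [c1 c2 c3 c4|];
  last by ring.
rewrite -> !phiE, !rE; ring.
Qed.

Lemma trivial_braided_commutative : braided_commutative mul r.
Proof.
move=> a b; transitivity (b \m a).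
  apply: (sweedler2_counitr (G := fun x => b \m x)) => [|a1 a2].
    by apply: linear_comp; apply: linear_tensr.
  apply: (sweedler2_counitr (G := fun x => eps a2 *: (x \m a1))) => [|b1 b2].
    by apply: linear_scale; apply: linear_comp; apply: linear_tensl.
  by rewrite rE scalerA mulrC.
rewrite -> mulC; apply/esym.
apply: (sweedler2_counitl (G := fun x => x \m b)) => [|a1 a2].
  by apply: linear_comp; apply: linear_tensl.
apply: (sweedler2_counitl (G := fun x => eps a1 *: (a2 \m x))) => [|b1 b2].
  by apply: linear_scale; apply: linear_comp; apply: linear_tensr.
by rewrite rE scalerA mulrC.
Qed.

Lemma trivial_coquasitriangular : admits_coquasitriangular_majid C.
Proof.
have phi1 : assoc_normalized one phi.
  by move=> a b; rewrite phiE oneP.2 mulr1.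
have antipode : exists S alpha beta,
    quasi_antipode mul one phi phi S alpha beta.
  by exists S, eps, eps; apply: trivial_quasi_antipode.
exists (MajidAlgebra mulP oneP mul1 trivial_associator_invertible
  trivial_quasi_associative trivial_pentagon phi1 antipode).
by split; exists r r; [ apply: trivial_braiding_invertible
  | apply: trivial_hexagonl | apply: trivial_hexagonr
  | apply: trivial_braided_commutative].
Qed.

End CommutativeHopf.

(** Take products of counits for the associator and the braiding: by the
    counit laws each axiom becomes an axiom of commutative Hopf algebras. *)
Lemma commutative_hopf_coquasitriangular (k : fieldType) (C : coalgebra k)
    (mul : {linear {malg k[(cobasis C * cobasis C)%type]}
                   -> {malg k[cobasis C]}})
    (one : {malg k[cobasis C]})
    (S : {linear {malg k[cobasis C]} -> {malg k[cobasis C]}}) :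
  mul_coalgebra_morphism mul -> unit_coalgebra_morphism one -> unital mul one ->
  (forall a b c, mul (a \ox mul (b \ox c)) = mul (mul (a \ox b) \ox c)) ->
  (forall a b, mul (a \ox b) = mul (b \ox a)) ->
  coalgebra_antimorphism S ->
  (forall a, \sw[comul C]_(a1, a2 <- a) mul (S a1 \ox a2)
    = counit C a *: one) ->
  (forall a, \sw[comul C]_(a1, a2 <- a) mul (a1 \ox S a2)
    = counit C a *: one) ->
  admits_coquasitriangular_majid C.
Proof.
move=> mulP oneP mul1 mulA mulC SP mulSl mulSr.
exact: (trivial_coquasitriangular mulP oneP mul1 mulA mulC SP mulSl mulSr
  (@trivial_associatorE _ C) (@trivial_braidingE _ C)).
Qed.

(** * Shuffles of words *)

Section Shuffle.

Variable T : Type.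
Implicit Types (a b c : T) (u v w p : seq T).

(** Interleavings are listed with multiplicity, so that the sum over this list
    is the shuffle product. *)
Fixpoint shuffle u v : seq (seq T) :=
  if u is a :: u' then
    (fix shuffle_u v := if v is b :: v' then
       map (cons a) (shuffle u' v) ++ map (cons b) (shuffle_u v')
     else [:: u]) v
  else [:: v].

Arguments shuffle : simpl never.

Lemma shuffle0s v : shuffle [::] v = [:: v].
Proof. by []. Qed.

Lemma shuffles0 u : shuffle u [::] = [:: u].
Proof. by case: u. Qed.

Lemma shuffle_cons a u b v :
  shuffle (a :: u) (b :: v) =
  map (cons a) (shuffle u (b :: v)) ++ map (cons b) (shuffle (a :: u) v).
Proof. by []. Qed.

Section Sums.

Variable V : zmodType.
Implicit Type F : seq T -> V.

Lemma sum_shuffle0s F v : \sum_(w <- shuffle [::] v) F w = F v.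
Proof. exact: big_seq1. Qed.

Lemma sum_shuffles0 F u : \sum_(w <- shuffle u [::]) F w = F u.
Proof. by rewrite shuffles0 big_seq1. Qed.

Lemma sum_shuffle_cons F a u b v :
  \sum_(w <- shuffle (a :: u) (b :: v)) F w =
  \sum_(w <- shuffle u (b :: v)) F (a :: w)
  + \sum_(w <- shuffle (a :: u) v) F (b :: w).
Proof. by rewrite shuffle_cons big_cat !big_map. Qed.

Lemma sum_shuffleC F u v :
  \sum_(w <- shuffle u v) F w = \sum_(w <- shuffle v u) F w.
Proof.
elim: u v F => [|a u IHu] v F.
  by rewrite [LHS]sum_shuffle0s [RHS]sum_shuffles0.
elim: v F => [|b v IHv] F.
  by rewrite [LHS]sum_shuffles0 [RHS]sum_shuffle0s.
by rewrite !sum_shuffle_cons IHu IHv addrC.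
Qed.

(** Both sides run over the interleavings of three words; they are compared
    according to the word that contributes the first letter. *)
Lemma sum_shuffleA F u v w :
  \sum_(x <- shuffle u v) \sum_(z <- shuffle x w) F z =
  \sum_(y <- shuffle v w) \sum_(z <- shuffle u y) F z.
Proof.
elim: u v w F => [|a u IHu] v w F.
  by rewrite sum_shuffle0s; under [RHS]eq_bigr do rewrite sum_shuffle0s.
elim: v w F => [|b v IHv] w F; first by rewrite sum_shuffles0 sum_shuffle0s.
elim: w F => [|c w IHw] F.
  by under eq_bigr do rewrite sum_shuffles0; rewrite sum_shuffles0.
rewrite !sum_shuffle_cons.
under eq_bigr do rewrite sum_shuffle_cons.
under [X in _ + X]eq_bigr do rewrite sum_shuffle_cons.
under [X in _ = X + _]eq_bigr do rewrite sum_shuffle_cons.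
under [X in _ = _ + X]eq_bigr do rewrite sum_shuffle_cons.
rewrite !big_split /= (IHu _ _ (fun z => F (a :: z))).
rewrite (IHv _ (fun z => F (b :: z))) -(IHw (fun z => F (c :: z))).
rewrite !sum_shuffle_cons -!addrA; congr (_ + _).
by rewrite [RHS]addrCA; congr (_ + _); rewrite addrCA.
Qed.

(** The recursion on last letters: the antipode reverses words, and with them
    the recursion on first letters. *)
Lemma sum_shuffle_rcons F u a v b :
  \sum_(w <- shuffle (rcons u a) (rcons v b)) F w =
  \sum_(w <- shuffle u (rcons v b)) F (rcons w a)
  + \sum_(w <- shuffle (rcons u a) v) F (rcons w b).
Proof.
elim: u v F => [|c u IHu] v F.
  elim: v F => [|d v IHv] F /=.
    by rewrite !big_cons !big_nil !addr0 addrC.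
  rewrite -[rcons [::] a]/[:: a] in IHv *.
  rewrite !sum_shuffle_cons IHv !sum_shuffle0s /= addrCA; congr (_ + _).
elim: v F => [|d v IHv] F; rewrite ?rcons_cons.
  rewrite -[rcons [::] b]/[:: b] sum_shuffle_cons (IHu [::]) !sum_shuffles0.
  by rewrite sum_shuffle_cons !sum_shuffles0 addrAC.
rewrite sum_shuffle_cons -rcons_cons IHu -rcons_cons IHv.
by rewrite !rcons_cons !sum_shuffle_cons !addrA; congr (_ + _); rewrite addrAC.
Qed.

Lemma sum_shuffle_rev F u v :
  \sum_(w <- shuffle (rev u) (rev v)) F w
  = \sum_(w <- shuffle u v) F (rev w).
Proof.
elim: u v F => [|a u IHu] v F; first by rewrite !sum_shuffle0s.
elim: v F => [|b v IHv] F; first by rewrite !sum_shuffles0.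
rewrite !rev_cons sum_shuffle_rcons -!rev_cons IHu IHv sum_shuffle_cons.
by congr (_ + _); apply: eq_bigr => w _; rewrite rev_cons.
Qed.

(** Bookkeeping for the next lemma.  The pair (i, j) stands for a cut of
    [a :: u] after i letters and of [b :: v] after j letters; [A] counts the
    interleavings of the left pieces that start with [a], and [B] those that
    start with [b]. *)
Lemma sum_grid_split (X A B : nat -> nat -> V) (m n : nat) :
  (forall i, X i.+1 0%N = A i 0%N) -> (forall j, X 0%N j.+1 = B 0%N j) ->
  (forall i j, X i.+1 j.+1 = A i j.+1 + B i.+1 j) ->
  \sum_(i < m.+2) \sum_(j < n.+2) X i j =
  X 0%N 0%N + (\sum_(i < m.+1) \sum_(j < n.+2) A i j
           + \sum_(i < m.+2) \sum_(j < n.+1) B i j).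
Proof.
move=> X0 X0' XS; rewrite big_ord_recl [X in X + _ = _]big_ord_recl -addrA.
congr (_ + _).
have row i : \sum_(j < n.+2) X i.+1 j
    = \sum_(j < n.+2) A i j + \sum_(j < n.+1) B i.+1 j.
  rewrite big_ord_recl X0 [in RHS]big_ord_recl -addrA -big_split.
  by congr (_ + _); apply: eq_bigr => j _; apply: XS.
under [X in _ + X = _]eq_bigr => i _ do rewrite row.
rewrite big_split /= addrCA; congr (_ + _).
rewrite [RHS]big_ord_recl; congr (_ + _).
by apply: eq_bigr => j _; apply: X0'.
Qed.

(** Cutting an interleaving amounts to cutting both words and interleaving the
    left pieces and the right pieces: hence the shuffle product is a morphism
    of coalgebras. *)
Lemma sum_shuffle_deconcatenation (F : seq T -> seq T -> V) u v :
  \sum_(w <- shuffle u v) \sum_(i < (size w).+1) F (take i w) (drop i w)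
  = \sum_(i < (size u).+1) \sum_(j < (size v).+1)
      \sum_(s <- shuffle (take i u) (take j v))
      \sum_(t <- shuffle (drop i u) (drop j v)) F s t.
Proof.
elim: u v F => [|a u IHu] v F.
  rewrite sum_shuffle0s big_ord1; apply: eq_bigr => j _ /=.
  by rewrite !sum_shuffle0s.
elim: v F => [|b v IHv] F.
  rewrite sum_shuffles0; apply: eq_bigr => i _.
  by rewrite big_ord1 /= !sum_shuffles0.
have split w c G :
    \sum_(i < (size (c :: w)).+1) G (take i (c :: w)) (drop i (c :: w))
    = G [::] (c :: w) + \sum_(i < (size w).+1) G (c :: take i w) (drop i w)
    :> V.
  by rewrite big_ord_recl.
rewrite sum_shuffle_cons; under eq_bigr do rewrite split.
under [X in _ + X]eq_bigr do rewrite split.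
rewrite !big_split /= (IHu _ (fun s => F (a :: s))) (IHv (fun s => F (b :: s))).
rewrite addrACA -(sum_shuffle_cons (F [::])).
pose X i j := \sum_(s <- shuffle (take i (a :: u)) (take j (b :: v)))
  \sum_(t <- shuffle (drop i (a :: u)) (drop j (b :: v))) F s t.
pose A i j := \sum_(s <- shuffle (take i u) (take j (b :: v)))
  \sum_(t <- shuffle (drop i u) (drop j (b :: v))) F (a :: s) t.
pose B i j := \sum_(s <- shuffle (take i (a :: u)) (take j v))
  \sum_(t <- shuffle (drop i (a :: u)) (drop j v)) F (b :: s) t.
rewrite -/(shuffle _ _); symmetry.
rewrite [LHS](sum_grid_split (X := X) (A := A) (B := B)) /X /A /B /=.
- by rewrite sum_shuffle0s.
- by move=> i; rewrite !sum_shuffles0.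
- by move=> j; rewrite !sum_shuffle0s.
- by move=> i j; rewrite sum_shuffle_cons.
Qed.

End Sums.

Section Antipode.

Variables (R : nzRingType) (V : lmodType R).
Implicit Type F : seq T -> V.

(** A telescoping sum.  The words of the i-th term start either with the letter
    moved last into the reversed prefix or with the first letter of the
    remaining suffix; the latter are the former for the term i + 1, with the
    opposite sign.  Only the words that start with [c] in the first term
    survive.  The accumulator [p] of [catrev] makes the induction go through. *)
Lemma alternating_shuffle_catrev F c p w :
  \sum_(i < (size w).+1) (-1) ^+ i *:
    \sum_(z <- shuffle (catrev (take i w) (c :: p)) (drop i w)) F z
  = \sum_(z <- shuffle p w) F (c :: z).
Proof.
elim: w c p => [|a w IHw] c p.
  by rewrite big_ord1 expr0 scale1r !sum_shuffles0.
rewrite big_ord_recl /= expr0 scale1r sum_shuffle_cons.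
under eq_bigr do rewrite exprS mulN1r scaleNr.
by rewrite sumrN IHw addrK.
Qed.

(** For a nonempty word the first term is [w] itself, and it cancels against
    the telescoped remainder. *)
Lemma sum_shuffle_antipode F w :
  \sum_(i < (size w).+1) (-1) ^+ i *:
    \sum_(z <- shuffle (rev (take i w)) (drop i w)) F z
  = if w is [::] then F [::] else 0.
Proof.
case: w => [|a w]; first by rewrite big_ord1 expr0 scale1r sum_shuffle0s.
rewrite big_ord_recl /= expr0 scale1r sum_shuffle0s.
under eq_bigr do rewrite exprS mulN1r scaleNr.
by rewrite sumrN alternating_shuffle_catrev sum_shuffle0s subrr.
Qed.

(** Reversal of words commutes with shuffling, and exchanges the two antipode
    identities up to a global sign. *)
Lemma sum_shuffle_antipode_rev F w :
  \sum_(i < (size w).+1) (-1) ^+ (size w - i) *: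
    \sum_(z <- shuffle (rev (drop i w)) (take i w)) F z
  = if w is [::] then F [::] else 0.
Proof.
transitivity ((-1) ^+ size w *: (if w is [::] then F (rev [::]) else 0)).
  rewrite -(sum_shuffle_antipode (F \o rev)) scaler_sumr; apply: eq_bigr => i _.
  rewrite scalerA -exprD; congr (_ *: _).
    by rewrite -signr_odd -[RHS]signr_odd oddD oddB // -ltnS.
  by rewrite sum_shuffleC -sum_shuffle_rev revK.
by case: w => [|a w]; rewrite ?scaler0 // expr0 scale1r.
Qed.

End Antipode.

End Shuffle.

(** * The shuffle Hopf algebra on labelled words *)

Lemma tens_suml (k : fieldType) (A B : choiceType) I (r : seq I)
    (F : I -> {malg k[A]}) (y : {malg k[B]}) :
  (\sum_(i <- r) F i) \ox y = \sum_(i <- r) (F i \ox y).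
Proof. by rewrite /tens linear_sum. Qed.

Lemma tens_sumr (k : fieldType) (A B : choiceType) I (r : seq I)
    (x : {malg k[A]}) (F : I -> {malg k[B]}) :
  x \ox (\sum_(i <- r) F i) = \sum_(i <- r) (x \ox F i).
Proof.
elim: r => [|i r IHr]; last first.
  rewrite !big_cons -IHr -[F i in LHS]scale1r.
  by rewrite (linear_tensr x (@linear_idP _ _)) scale1r.
rewrite !big_nil -(scale0r 0).
by rewrite (linearZ_of _ _ (linear_tensr x (@linear_idP _ _))) scale0r.
Qed.

Lemma tensZ (k : fieldType) (A B : choiceType) (c e : k)
    (x : {malg k[A]}) (y : {malg k[B]}) :
  (c *: x) \ox (e *: y) = (c * e) *: (x \ox y).
Proof.
rewrite (linearZ_of _ _ (linear_tensr _ (@linear_idP _ _))) /tens linearZ.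
by rewrite scalerA mulrC.
Qed.

Section LabelledPaths.

Variables (G : groupType) (L : choiceType) (deg : L -> G).
Hypothesis mulgC : forall x y : G, commute x y.

(** A path with labels [w] that starts at x ends at [total_degree w * x]. *)
Fixpoint total_degree (w : seq L) : G :=
  (if w is a :: w' then total_degree w' * deg a else 1)%g.

Local Notation dg := total_degree.

Lemma total_degree_cat u v : dg (u ++ v) = (dg v * dg u)%g.
Proof. by elim: u => [|a u IHu] /=; rewrite ?mulg1 // IHu mulgA. Qed.

Lemma total_degree_take_drop i w : (dg (take i w) * dg (drop i w) = dg w)%g.
Proof. by rewrite mulgC -total_degree_cat cat_take_drop. Qed.

Lemma total_degree_rev w : dg (rev w) = dg w.
Proof.
elim: w => //= a w IHw; rewrite rev_cons -cats1 total_degree_cat IHw /=.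
by rewrite mul1g mulgC.
Qed.

(** As [G] is abelian, the endpoint of a path is insensitive to the order in
    which the letters of [u] and [v] are interleaved. *)
Lemma total_degree_shuffle u v w :
  w \in shuffle u v -> dg w = (dg u * dg v)%g.
Proof.
elim: u v w => [|a u IHu] v w.
  by rewrite shuffle0s inE => /eqP->; rewrite mul1g.
elim: v w => [|b v IHv] w.
  by rewrite shuffles0 inE => /eqP->; rewrite mulg1.
rewrite shuffle_cons mem_cat => /orP[] /mapP[z zs ->] /=.
  by rewrite (IHu _ _ zs) -!mulgA; congr (_ * _)%g; rewrite [RHS]mulgC !mulgA.
by rewrite (IHv _ zs) !mulgA.
Qed.

Variables (k : fieldType) (C : coalgebra k).
Local Notation H := {malg k[cobasis C]}.
Local Notation d := (comul C).
Local Notation eps := (counit C).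

(** The vector [e x w] is the path that starts at [x] and has labels [w].  Only
    the comultiplication of these basis vectors matters, so they are abstract
    vectors of an abstract coalgebra. *)
Variable e : G -> seq L -> H.
Hypothesis basis_e : forall b : cobasis C, exists x w, << b >> = e x w.
Hypothesis comul_e : forall x w,
  d (e x w)
  = \sum_(i < (size w).+1)
      (e (dg (take i w) * x)%g (drop i w) \ox e x (take i w)).
Hypothesis sweedler2_e : forall (V : lmodType k) (F : H -> H -> V) x w,
  \sw[d]_(a1, a2 <- e x w) F a1 a2
  = \sum_(i < (size w).+1)
      F (e (dg (take i w) * x)%g (drop i w)) (e x (take i w)).
Hypothesis counit_e : forall x w, eps (e x w) = (size w == 0%N)%:R.

Variable mul : {linear {malg k[(cobasis C * cobasis C)%type]} -> H}.
Variable S : {linear H -> H}.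
Local Notation "a \m b" := (mul (a \ox b)) (at level 40, left associativity).
Hypothesis mul_e : forall x u y v,
  e x u \m e y v = \sum_(w <- shuffle u v) e (x * y)%g w.
Hypothesis S_e : forall x u,
  S (e x u) = (-1) ^+ size u *: e (x * dg u)^-1%g (rev u).

Lemma linear_ext_e (V : lmodType k) (f g : H -> V) :
  linear f -> linear g -> (forall x w, f (e x w) = g (e x w)) -> f =1 g.
Proof.
by move=> lf lg fg; apply: linear_ext => // b; have [x [w ->]] := basis_e b.
Qed.

Lemma bilinear_ext_e (V : lmodType k) (f g : H -> H -> V) :
  (forall y, linear (f^~ y)) -> (forall x, linear (f x)) ->
  (forall y, linear (g^~ y)) -> (forall x, linear (g x)) ->
  (forall x u y v, f (e x u) (e y v) = g (e x u) (e y v)) -> f =2 g.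
Proof.
move=> fl fr gl gr fg; apply: bilinear_ext => // b c.
by have [x [u ->]] := basis_e b; have [y [v ->]] := basis_e c.
Qed.

Lemma linear_prodl b : linear (fun a => a \m b).
Proof. by apply: linear_comp; apply: linear_tensl. Qed.

Lemma linear_prodr a : linear (fun b => a \m b).
Proof. by apply: linear_comp; apply: linear_tensr. Qed.

Lemma shuffle_mul_comul a b :
  d (a \m b)
  = \sw[d]_(a1, a2 <- a) \sw[d]_(b1, b2 <- b) ((a1 \m b1) \ox (a2 \m b2)).
Proof.
move: a b; apply: bilinear_ext_e => [b|a|b|a|x u y v].
- by apply: linear_comp; apply: linear_prodl.
- by apply: linear_comp; apply: linear_prodr.
- exact: linear_sweedler2.
- by apply: linear_under_sweedler2 => a1 a2; apply: linear_sweedler2.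
rewrite -> mul_e; rewrite linear_sum; under eq_bigr do rewrite comul_e.
rewrite (sum_shuffle_deconcatenation
  (fun s t => e (dg s * (x * y))%g t \ox e (x * y)%g s)).
rewrite sweedler2_e; apply: eq_bigr => i _; rewrite sweedler2_e.
apply: eq_bigr => j _; rewrite -> !mul_e, tens_sumr.
apply: eq_big_seq => s /total_degree_shuffle->; rewrite tens_suml.
apply: eq_bigr => t _; congr (e _ _ \ox _).
rewrite -!mulgA; congr (_ * _)%g; rewrite !mulgA.
by congr (_ * _)%g; rewrite mulgC.
Qed.

Lemma shuffle_mul_counit a b : eps (a \m b) = eps a * eps b.
Proof.
move: a b; apply: bilinear_ext_e => [b|a|b|a|x u y v].
- by apply: linear_comp; apply: linear_prodl.
- by apply: linear_comp; apply: linear_prodr.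
- by apply: linear_mull; apply: linearP.
- by apply: linear_mulr; apply: linearP.
rewrite mul_e linear_sum /=; under eq_bigr do rewrite counit_e.
rewrite !counit_e; case: u v => [|a u] [|b v].
- by rewrite sum_shuffle0s mul1r.
- by rewrite sum_shuffle0s mulr0.
- by rewrite sum_shuffles0 mul0r.
by rewrite sum_shuffle_cons !big1 ?addr0 ?mul0r.
Qed.

Lemma shuffle_unital : unital (C := C) mul (e 1%g [::]).
Proof.
move=> a; split; move: a; apply: linear_ext_e => //.
- exact: linear_prodr.
- by move=> x w; rewrite mul_e sum_shuffle0s mul1g.
- exact: linear_prodl.
- by move=> x w; rewrite mul_e sum_shuffles0 mulg1.
Qed.

Lemma shuffle_mulA a b c : a \m (b \m c) = (a \m b) \m c.
Proof.
move: a; apply: linear_ext_e => [||x u].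
- exact: linear_prodl.
- apply: linear_comp; apply: linear_tensl; exact: linear_prodl.
move: b c; apply: bilinear_ext_e => [c|b|c|b|y v z w].
- by apply: linear_comp; apply: linear_tensr; apply: linear_prodl.
- by apply: linear_comp; apply: linear_tensr; apply: linear_prodr.
- by apply: linear_comp; apply: linear_tensl; apply: linear_prodr.
- exact: linear_prodr.
rewrite -> !mul_e, tens_suml, tens_sumr.
rewrite [LHS]linear_sum [RHS]linear_sum.
under eq_bigr do rewrite mul_e mulgA.
under [RHS]eq_bigr do rewrite mul_e.
by rewrite sum_shuffleA.
Qed.

Lemma shuffle_mulC a b : a \m b = b \m a.
Proof.
move: a b; apply: bilinear_ext_e => [b|a|b|a|x u y v].
- exact: linear_prodl.
- exact: linear_prodr.
- exact: linear_prodr.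
- exact: linear_prodl.
by rewrite -> !mul_e; rewrite sum_shuffleC (mulgC x y).
Qed.

Lemma shuffle_antipode_comul a :
  d (S a) = \sw[d]_(a1, a2 <- a) (S a2 \ox S a1).
Proof.
move: a; apply: linear_ext_e => [||x w].
- by apply: linear_comp; apply: linearP.
- exact: linear_sweedler2.
rewrite S_e linearZ /= comul_e sweedler2_e scaler_sumr size_rev.
rewrite (reindex_inj rev_ord_inj); apply: eq_bigr => i _ /=.
have le_i : (i <= size w)%N by rewrite -ltnS.
rewrite !S_e [RHS]tensZ -exprD (size_takel le_i) size_drop (subnKC le_i) subSS.
congr (_ *: (e _ _ \ox e _ _)).
- rewrite take_rev total_degree_rev subKn // -(total_degree_take_drop i w).
  by rewrite [(x * _)%g]mulgA invgM mulgA mulgV mul1g.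
- by rewrite drop_rev subKn.
- congr (_^-1)%g; rewrite -(total_degree_take_drop i w) mulgA.
  by congr (_ * _)%g; rewrite mulgC.
- by rewrite take_rev subKn.
Qed.

Lemma shuffle_antipode_counit a : eps (S a) = eps a.
Proof.
move: a; apply: linear_ext_e => [||x w].
- by apply: linear_comp; apply: linearP.
- exact: linearP.
rewrite S_e linearZ /= !counit_e size_rev.
by case: w => [|a w]; rewrite ?scaler0 // scale1r.
Qed.

Lemma shuffle_antipodel a :
  \sw[d]_(a1, a2 <- a) (S a1 \m a2) = eps a *: (e 1%g [::]).
Proof.
move: a; apply: linear_ext_e => [||x w].
- exact: linear_sweedler2.
- by apply: linear_scalel; apply: linearP.
rewrite sweedler2_e counit_e.
transitivity (\sum_(i < (size w).+1) (-1) ^+ (size w - i) *: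
    \sum_(z <- shuffle (rev (drop i w)) (take i w)) e ((x * dg w)^-1 * x)%g z).
  apply: eq_bigr => i _; rewrite S_e size_drop.
  rewrite (linearZ_of _ _ (linear_prodl _)) mul_e.
  congr (_ *: _); apply: eq_bigr => z _; congr (e (_^-1 * _) _)%g.
  rewrite -(total_degree_take_drop i w) mulgA; congr (_ * _)%g; exact: mulgC.
rewrite sum_shuffle_antipode_rev; case: w => [|a w] /=; last by rewrite scale0r.
by rewrite mulg1 mulVg scale1r.
Qed.

Lemma shuffle_antipoder a :
  \sw[d]_(a1, a2 <- a) (a1 \m S a2) = eps a *: (e 1%g [::]).
Proof.
move: a; apply: linear_ext_e => [||x w].
- exact: linear_sweedler2.
- by apply: linear_scalel; apply: linearP.
rewrite sweedler2_e counit_e.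
transitivity (\sum_(i < (size w).+1) (-1) ^+ i *:
    \sum_(z <- shuffle (rev (take i w)) (drop i w)) e 1%g z).
  apply: eq_bigr => i _; rewrite S_e (size_takel (ltn_ord i : i <= size w)%N).
  rewrite (linearZ_of _ _ (linear_prodr _)) mul_e sum_shuffleC.
  congr (_ *: _); apply: eq_bigr => z _; congr (e _ _).
  by rewrite [(x * _)%g]mulgC mulgV.
rewrite sum_shuffle_antipode; case: w => [|a w] /=; last by rewrite scale0r.
by rewrite scale1r.
Qed.

(** All the axioms are checked on the basis, where they are the identities
    between sums over shuffles established above. *)
Lemma shuffle_coquasitriangular :
  admits_coquasitriangular_majid C.
Proof.
apply: (commutative_hopf_coquasitriangular (C := C)
  (mul := mul) (one := (e 1%g [::])) (S := S)).
- by split; [apply: shuffle_mul_comul | apply: shuffle_mul_counit].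
- split; first by rewrite /= comul_e big_ord1 /= mul1g.
  by rewrite /= counit_e.
- exact: shuffle_unital.
- exact: shuffle_mulA.
- exact: shuffle_mulC.
- by split; [apply: shuffle_antipode_comul | apply: shuffle_antipode_counit].
- exact: shuffle_antipodel.
- exact: shuffle_antipoder.
Qed.

End LabelledPaths.

(** * Paths of a Hopf quiver as labelled words *)

Section HopfQuiverPaths.

Variables (G : groupType) (R : ramification G) (Q : quiver).
Variable f : quiver_iso Q (hopf_quiver R).
Local Notation L := {c : G & 'I_(R c)}.
Local Notation dg := (total_degree (fun c : L => tag c)).

Variables (vertex_of : G -> vertex Q) (arrow_of : G * L -> arrow Q).
Hypotheses (iso_vertexK : cancel (iso_vertex f) vertex_of)
           (vertex_ofK : cancel vertex_of (iso_vertex f)).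
Hypotheses (iso_arrowK : cancel (iso_arrow f) arrow_of)
           (arrow_ofK : cancel arrow_of (iso_arrow f)).

Lemma src_arrow_of x c : src (arrow_of (x, c)) = vertex_of x.
Proof.
by apply: (can_inj iso_vertexK); rewrite -iso_src arrow_ofK vertex_ofK.
Qed.

Lemma tgt_arrow_of x c : tgt (arrow_of (x, c)) = vertex_of (tag c * x)%g.
Proof.
by apply: (can_inj iso_vertexK); rewrite -iso_tgt arrow_ofK vertex_ofK.
Qed.

Fixpoint trace (x : G) (w : seq L) : seq (arrow Q) :=
  if w is c :: w' then arrow_of (x, c) :: trace (tag c * x)%g w' else [::].

Lemma composable_trace x w : composable (vertex_of x) (trace x w).
Proof.
by elim: w x => //= c w IHw x; rewrite src_arrow_of tgt_arrow_of eqxx IHw.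
Qed.

Definition labelled_path x w : qpath Q :=
  exist (fun p => composable p.1 p.2) (vertex_of x, trace x w)
    (composable_trace x w).

Definition path_start (p : qpath Q) : G := iso_vertex f (qstart p).

Definition path_labels (p : qpath Q) : seq L :=
  [seq (iso_arrow f a).2 | a <- qarrows p].

(** An arrow is determined by its source and its label, so that a path is
    determined by its starting vertex and the labels of its arrows. *)
Lemma labelled_pathK p : labelled_path (path_start p) (path_labels p) = p.
Proof.
apply: val_inj; case: p => [[x w] xw].
rewrite /path_labels /path_start /qstart /qarrows /= in xw *.
rewrite iso_vertexK; congr (_, _).
elim: w x xw => //= a w IHw x /andP[/eqP <- aw].
have fa : iso_arrow f a = (iso_vertex f (src a), (iso_arrow f a).2).
  by rewrite -iso_src -surjective_pairing.
have ta : (tag (iso_arrow f a).2 * iso_vertex f (src a))%g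
    = iso_vertex f (tgt a).
  by rewrite -iso_src -iso_tgt.
by rewrite -fa iso_arrowK ta IHw.
Qed.

Lemma path_start_labelled x w : path_start (labelled_path x w) = x.
Proof. exact: vertex_ofK. Qed.

Lemma path_labels_labelled x w : path_labels (labelled_path x w) = w.
Proof.
rewrite /path_labels /qarrows /=.
by elim: w x => //= c w IHw x; rewrite arrow_ofK IHw.
Qed.

Lemma size_trace x w : size (trace x w) = size w.
Proof. by elim: w x => //= c w IHw x; rewrite IHw. Qed.

Lemma take_trace i x w : take i (trace x w) = trace x (take i w).
Proof. by elim: w x i => [|c w IHw] x [|i] //=; rewrite IHw. Qed.

Lemma drop_trace i x w :
  drop i (trace x w) = trace (dg (take i w) * x)%g (drop i w).
Proof.
elim: w x i => [|c w IHw] x [|i] //=; first by rewrite mul1g.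
by rewrite IHw mulgA.
Qed.

Lemma endpoint_trace x w :
  endpoint (vertex_of x) (trace x w) = vertex_of (dg w * x)%g.
Proof.
rewrite /endpoint; elim: w x => [|c w IHw] x /=; first by rewrite mul1g.
by rewrite tgt_arrow_of IHw mulgA.
Qed.

Lemma qtake_labelled i x w :
  qtake i (labelled_path x w) = labelled_path x (take i w).
Proof. by apply: val_inj; rewrite /= take_trace. Qed.

Lemma qdrop_labelled i x w :
  qdrop i (labelled_path x w) = labelled_path (dg (take i w) * x)%g (drop i w).
Proof.
apply: val_inj; rewrite /= /qstart /qarrows /=.
by rewrite take_trace endpoint_trace drop_trace.
Qed.

Variable k : fieldType.
Local Notation H := {malg k[qpath Q]}.
Local Notation e x w := (<< labelled_path x w >> : H).

Definition shuffle_product : {linear {malg k[(qpath Q * qpath Q)%type]} -> H} :=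
  lext (fun p : qpath Q * qpath Q =>
    \sum_(w <- shuffle (path_labels p.1) (path_labels p.2))
      e (path_start p.1 * path_start p.2)%g w).

Definition shuffle_antipode : {linear H -> H} :=
  lext (fun p : qpath Q =>
    (-1) ^+ size (path_labels p)
      *: e (path_start p * dg (path_labels p))^-1%g (rev (path_labels p))).

Lemma shuffle_productE x u y v :
  shuffle_product (e x u \ox e y v) = \sum_(w <- shuffle u v) e (x * y)%g w.
Proof.
by rewrite tensUU [LHS]lextU /= !path_start_labelled !path_labels_labelled.
Qed.

Lemma shuffle_antipodeE x u :
  shuffle_antipode (e x u) = (-1) ^+ size u *: e (x * dg u)^-1%g (rev u).
Proof. by rewrite [LHS]lextU path_start_labelled path_labels_labelled. Qed.

Lemma qlength_labelled x w : qlength (labelled_path x w) = size w.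
Proof. exact: size_trace. Qed.

Lemma hopf_quiver_coquasitriangular :
  (forall x y : G, commute x y) ->
  admits_coquasitriangular_majid (path_coalgebra k Q).
Proof.
move=> mulgC.
apply: (@shuffle_coquasitriangular G L (fun c => tag c) mulgC k
  (path_coalgebra k Q) (fun x w => e x w) _ _ _ _
  shuffle_product shuffle_antipode shuffle_productE shuffle_antipodeE).
- by move=> p; exists (path_start p), (path_labels p); rewrite labelled_pathK.
- move=> x w; rewrite /= path_comulU qlength_labelled; apply: eq_bigr => i _.
  by rewrite tensUU qtake_labelled qdrop_labelled.
- move=> V F x w; rewrite [LHS]sweedler2_path qlength_labelled.
  by apply: eq_bigr => i _; rewrite qtake_labelled qdrop_labelled.
- by move=> x w; rewrite /= path_counitU qlength_labelled.
Qed.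

End HopfQuiverPaths.

(** * The group of group-like elements *)

Section GroupOfLaws.
Variables (T : choiceType) (one : T) (inv : T -> T) (mul : T -> T -> T).
Hypotheses (mulA : associative mul).
Hypotheses (mul1 : left_id one mul) (mulr1 : right_id one mul).
Hypotheses (mulV : left_inverse one inv mul).
Hypotheses (mulVr : right_inverse one inv mul).

(** A copy of [T], on which the given laws can be declared canonical. *)
Definition group_of_laws : Type := T.
HB.instance Definition _ := Choice.on group_of_laws.
HB.instance Definition _ :=
  isGroup.Build group_of_laws mulA mul1 mulr1 mulV mulVr.

Lemma exists_groupType :
  exists (G : groupType) (f : T -> G) (g : G -> T),
    [/\ cancel f g, cancel g f, g 1%g = one
      & forall x y : G, g (x * y)%g = mul (g x) (g y)].
Proof. by exists group_of_laws, (fun x => x), (fun x => x). Qed.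
End GroupOfLaws.

(** [v] enumerates the group-like elements of [C].  The rule [sweedler2_v] holds
    for group-like basis vectors, such as vertices, whatever is summed. *)
Section GroupLikes.

Variables (k : fieldType) (C : coalgebra k) (M : majid_algebra C).
Variable cqM : coquasitriangular M.
Local Notation H := {malg k[cobasis C]}.
Local Notation d := (comul C).
Local Notation eps := (counit C).
Local Notation mul := (mj_mul M).
Local Notation phi := (mj_phi M).
Local Notation one := (mj_one M).
Local Notation "a \m b" := (mul (a \ox b)) (at level 40, left associativity).

Variables (X : choiceType) (v : X -> H).
Hypothesis v_inj : injective v.
Hypothesis sweedler2_v : forall (V : lmodType k) (F : H -> H -> V) x,
  \sw[d]_(a1, a2 <- v x) F a1 a2 = F (v x) (v x).
Hypothesis eps_v : forall x, eps (v x) = 1.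
Hypothesis grouplike_v : forall g,
  d g = g \ox g -> eps g = 1 -> exists x, g = v x.

(** The product of two group-like elements is group-like. *)
Lemma exists_vmul x y : exists z, v x \m v y == v z.
Proof.
have [dM eM] := mj_mulP M.
have [||z ->] := grouplike_v (g := v x \m v y); last by exists z.
  by rewrite dM; rewrite -> !sweedler2_v.
by rewrite eM !eps_v mulr1.
Qed.

Definition vmul x y := xchoose (exists_vmul x y).

Lemma vmulE x y : v x \m v y = v (vmul x y).
Proof. exact/eqP/(xchooseP (exists_vmul x y)). Qed.

Lemma exists_vone : exists z, one == v z.
Proof.
by have [d1 e1] := mj_oneP M; have [z ->] := grouplike_v d1 e1; exists z.
Qed.

Definition vone := xchoose exists_vone.

Lemma voneE : one = v vone.
Proof. exact/eqP/(xchooseP exists_vone). Qed.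

Lemma vmul1x : left_id vone vmul.
Proof. by move=> x; apply: v_inj; rewrite -vmulE -voneE (mj_unital M _).1. Qed.

Lemma vmulx1 : right_id vone vmul.
Proof. by move=> x; apply: v_inj; rewrite -vmulE -voneE (mj_unital M _).2. Qed.

(** Convolution inverses of functionals are pointwise inverses on group-like
    elements. *)
Lemma phi_v_neq0 x y z : phi (v x \ox v y \ox v z) != 0.
Proof.
have [E _] := mj_phi_inv M (v x) (v y) (v z); apply/eqP => p0; move: E.
rewrite -> !sweedler2_v, p0, !eps_v; rewrite mul0r !mulr1 => /esym/eqP.
by rewrite oner_eq0.
Qed.

Lemma r_v_neq0 x y : cq_r cqM (v x \ox v y) != 0.
Proof.
have [E _] := cq_inv cqM (v x) (v y); apply/eqP => p0; move: E.
rewrite -> !sweedler2_v, p0, !eps_v; rewrite mul0r !mulr1 => /esym/eqP.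
by rewrite oner_eq0.
Qed.

Lemma vmulA : associative vmul.
Proof.
move=> x y z; apply: v_inj; have := mj_mulqA M (v x) (v y) (v z).
rewrite -> !sweedler2_v, !vmulE; apply: scalerI; exact: phi_v_neq0.
Qed.

Lemma vmulC : commutative vmul.
Proof.
move=> x y; apply: v_inj; have := cq_comm cqM (v x) (v y).
rewrite -> !sweedler2_v, !vmulE => E.
by apply/esym; move: E; apply: scalerI; exact: r_v_neq0.
Qed.

(** The antipode maps group-like elements to group-like elements.  The identity
    Phi(x, S x, x) beta(x) alpha(x) = 1 shows that alpha(x) is nonzero, so it
    cancels in S(x) alpha(x) x = alpha(x) 1. *)
Lemma exists_vinv : exists vinv, left_inverse vone vinv vmul.
Proof.
have [S [al [be [[dS eS] Sl _ Sphi _]]]] := mj_antipodeP M.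
have ex x : exists z, S (v x) == v z.
  have [||z ->] := grouplike_v (g := S (v x)); last by exists z.
    by rewrite dS sweedler2_v.
  by rewrite eS eps_v.
have [vinv SE] : exists vinv, forall x, S (v x) = v (vinv x).
  by exists (fun x => xchoose (ex x)) => x; apply/eqP/(xchooseP (ex x)).
exists vinv => x; apply: v_inj.
have al0 : al (v x) != 0.
  apply/eqP => a0; have := Sphi (v x).
  rewrite /sweedler5 /sweedler4 /sweedler3.
  rewrite -> !sweedler2_v, a0, eps_v; rewrite mulr0 => /esym/eqP.
  by rewrite oner_eq0.
have := Sl (v x); rewrite /sweedler3; rewrite -> !sweedler2_v, voneE, SE, vmulE.
exact: scalerI.
Qed.

Lemma exists_vertex_group :
  exists (G : groupType) (f : X -> G) (g : G -> X),
    [/\ cancel f g, cancel g f, one = v (g 1%g),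
        forall x y : G, v (g x) \m v (g y) = v (g (x * y)%g)
      & forall x y : G, commute x y].
Proof.
have [vinv vmulV] := exists_vinv.
have vmulVr : right_inverse vone vinv vmul by move=> x; rewrite vmulC.
have [G [f [g [fK gK g1 gM]]]] :=
  exists_groupType vmulA vmul1x vmulx1 vmulV vmulVr.
exists G, f, g; split=> // [|x y|x y].
- by rewrite g1 voneE.
- by rewrite gM -vmulE.
- by apply: (can_inj gK); rewrite !gM vmulC.
Qed.

End GroupLikes.

(** * Skew-primitive elements *)

Section SkewPrimitives.

Variables (k : fieldType) (C : coalgebra k) (M : majid_algebra C).
Local Notation H := {malg k[cobasis C]}.
Local Notation d := (comul C).
Local Notation mul := (mj_mul M).
Local Notation phi := (mj_phi M).
Local Notation one := (mj_one M).
Local Notation "a \m b" := (mul (a \ox b)) (at level 40, left associativity).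

Variables (G : groupType) (v : G -> H).
Hypothesis sweedler2_v : forall (V : lmodType k) (F : H -> H -> V) x,
  \sw[d]_(a1, a2 <- v x) F a1 a2 = F (v x) (v x).
Hypothesis vM : forall x y, v x \m v y = v (x * y)%g.
Hypothesis v1 : one = v 1%g.

(** The coproduct of [a] is v(y) (x) a + a (x) v(x); it is stated as the rule
    for Sweedler sums over [a], for basis vectors such as arrows. *)
Definition skew_primitive (x y : G) (a : H) : Prop :=
  forall (V : lmodType k) (F : H -> H -> V),
    \sw[d]_(a1, a2 <- a) F a1 a2 = F (v y) a + F a (v x).

Lemma skew_primitive_mul x y a g : skew_primitive x y a ->
  d (a \m v g) = v (y * g)%g \ox (a \m v g) + (a \m v g) \ox v (x * g)%g.
Proof.
move=> sa; have [dM _] := mj_mulP M; rewrite dM; rewrite -> sa, !sweedler2_v.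
by rewrite -> !vM.
Qed.

(** Quasi-associativity at (a, g, g^-1).  As the associator is nonzero on
    group-like elements, a can be recovered from a g modulo the span of the
    group-like elements. *)
Lemma skew_primitive_mulK x y a g : skew_primitive x y a ->
  phi (v x \ox v g \ox v g^-1%g) *: a =
  phi (v y \ox v g \ox v g^-1%g) *: ((a \m v g) \m v g^-1%g)
  + phi (a \ox v g \ox v g^-1%g) *: (v x - v y).
Proof.
move=> sa; have := mj_mulqA M a (v g) (v g^-1%g).
rewrite -> !sa, !sweedler2_v, !vM.
have yE : (y * (g * g^-1) = y)%g by rewrite mulgV mulg1.
rewrite -> (mulgK g x), yE, (mulgV g), <- v1, (mj_unital M a).2.
have cancelP c (P A B P' : H) :
    c *: P + A = B + c *: P' -> A = B + c *: (P' - P).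
  by move=> E; rewrite scalerBr addrA -E addrAC subrr add0r.
exact: cancelP.
Qed.

End SkewPrimitives.

(** * Coefficients of the comultiplication of paths *)

Lemma linear_mcoeff (k : fieldType) (U : lmodType k) (B : choiceType)
    (f : U -> {malg k[B]}) (b : B) :
  linear f -> linear (fun x => (f x)@_b : k^o).
Proof. by move=> lf c x y; rewrite lf mcoeffD mcoeffZ. Qed.

Lemma mcoeff_tens (k : fieldType) (A B : choiceType)
    (x : {malg k[A]}) (y : {malg k[B]}) a b :
  (x \ox y)@_(a, b) = x@_a * y@_b.
Proof.
move: x y; apply: (@bilinear_ext k A B k^o) => [y|x|y|x|p q].
- by apply: linear_mcoeff; apply: linear_tensl.
- by apply: linear_mcoeff; apply: linear_tensr.
- by apply: linear_mull; apply: linear_mcoeff.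
- by apply: linear_mulr; apply: linear_mcoeff.
by rewrite tensUU !mcoeffU -natrM mulnb.
Qed.

Section PathCoefficients.

Variables (k : fieldType) (Q : quiver).
Local Notation H := {malg k[qpath Q]}.
Local Notation d := (@path_comul k Q).
Local Notation eps := (@path_counit k Q).

Definition vertex_path (x : vertex Q) : qpath Q :=
  exist (fun p => composable p.1 p.2) (x, [::]) isT.

Lemma arrow_composable (a : arrow Q) : composable (src a) [:: a].
Proof. by rewrite /= eqxx. Qed.

Definition arrow_path (a : arrow Q) : qpath Q :=
  exist (fun p => composable p.1 p.2) (src a, [:: a]) (arrow_composable a).

Lemma vertex_path_inj : injective vertex_path.
Proof. by move=> x y [->]. Qed.

Lemma arrow_path_inj : injective arrow_path.
Proof. by move=> a b [_ ->]. Qed.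

Lemma qlength0P (p : qpath Q) : qlength p = 0%N -> p = vertex_path (qstart p).
Proof. by case: p => [[x [|a w]]] xw //= _; apply: val_inj. Qed.

Lemma qlength1P (p : qpath Q) : qlength p = 1%N -> exists a, p = arrow_path a.
Proof.
case: p => [[x [|a [|b w]]]] xw //= _; exists a; apply: val_inj => /=.
by move: (xw) => /= /andP[/eqP->].
Qed.

(** A path is the concatenation of its two pieces. *)
Lemma qsplit_inj (p r : qpath Q) i j :
  (i <= qlength p)%N -> (j <= qlength r)%N ->
  qdrop i p = qdrop j r -> qtake i p = qtake j r -> p = r.
Proof.
move=> ip jr Ed Et; apply: val_inj.
rewrite [val p]surjective_pairing [val r]surjective_pairing.
congr (_, _); first by have /(congr1 (@qstart Q)) := Et.
rewrite -[LHS](cat_take_drop i) -[RHS](cat_take_drop j).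
have /(congr1 (@qarrows Q)) := Et; rewrite /qarrows /= => ->.
by have /(congr1 (@qarrows Q)) := Ed; rewrite /qarrows /= => ->.
Qed.

(** A pair of paths occurs in the comultiplication of one path at most, their
    concatenation, and there with coefficient 1. *)
Lemma mcoeff_comul_split (w : H) r i : (i <= qlength r)%N ->
  (d w)@_(qdrop i r, qtake i r) = w@_r.
Proof.
move=> ir; move: w; apply: (@linear_ext k (qpath Q) k^o) => [||p].
- by apply: linear_mcoeff; apply: linearP.
- exact: linear_mcoeff.
rewrite path_comulU raddf_sum /= mcoeffU.
under eq_bigr do rewrite mcoeffU.
have E j : (j <= qlength p)%N ->
    ((qdrop j p, qtake j p) == (qdrop i r, qtake i r)) = (p == r) && (j == i).
  move=> jp; apply/eqP/andP => [[] *|[/eqP-> /eqP->] //].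
  have [Ed Et] : qdrop j p = qdrop i r /\ qtake j p = qtake i r.
    by split; apply: val_inj; congr (_, _).
  split; apply/eqP; first exact: qsplit_inj jp ir Ed Et.
  by move: (congr1 (@qlength Q) Et); rewrite !qlength_qtake.
transitivity (\sum_(j < (qlength p).+1) ((p == r) && (j == i :> nat))%:R : k).
  by apply: eq_bigr => j _; rewrite E // -ltnS.
case: (altP (p =P r)) => [pr|_]; last by rewrite big1.
pose i' : 'I_(qlength r).+1 := Ordinal (ir : (i < (qlength r).+1)%N).
rewrite pr (bigD1 i') //= !eqxx big1 ?addr0 // => j /negbTE ji.
by rewrite -[j == i :> nat]/(j == i') ji.
Qed.

Lemma comul_support (w : H) p q : (d w)@_(p, q) != 0 ->
  exists r i, [/\ (i <= qlength r)%N, w@_r != 0, p = qdrop i r & q = qtake i r].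
Proof.
rewrite /path_comul /= /lext raddf_sum /= => nz.
have [/hasP[r rw]|] := boolP (has (fun r =>
    \sum_(i < (qlength r).+1) (<< (qdrop i r, qtake i r) >>)@_(p, q) != 0 :> k)
    (msupp w)).
  move=> nzr; suff /existsP[i /eqP E] :
    [exists i : 'I_(qlength r).+1, (qdrop i r, qtake i r) == (p, q)].
    exists r, i; case: E => -> ->; split=> //; first by rewrite -ltnS.
    by rewrite mcoeff_neq0.
  apply: contraNT nzr; rewrite negb_exists => /forallP nE.
  by rewrite big1 // => i _; rewrite mcoeffU (negbTE (nE i)).
move=> /hasPn z; case/eqP: nz; rewrite big_seq big1 // => r /z.
rewrite negbK => /eqP z0.
by rewrite mcoeffZ raddf_sum z0 mulr0.
Qed.

Lemma sweedler2_vertex (V : lmodType k) (F : H -> H -> V) x :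
  \sw[d]_(a1, a2 <- << vertex_path x >>) F a1 a2
  = F << vertex_path x >> << vertex_path x >>.
Proof.
rewrite [LHS]sweedler2_path big_ord1 /= qdrop0.
by have -> : qtake 0 (vertex_path x) = vertex_path x by apply: val_inj.
Qed.

Lemma sweedler2_arrow (V : lmodType k) (F : H -> H -> V) a :
  \sw[d]_(a1, a2 <- << arrow_path a >>) F a1 a2
  = F << vertex_path (tgt a) >> << arrow_path a >>
    + F << arrow_path a >> << vertex_path (src a) >>.
Proof.
rewrite [LHS]sweedler2_path big_ord_recl big_ord1 [LHS]addrC /= -[bump 0 0]/1%N.
rewrite qdrop0.
have -> : qtake 0 (arrow_path a) = vertex_path (src a) by apply: val_inj.
have -> : qdrop 1 (arrow_path a) = vertex_path (tgt a) by apply: val_inj.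
by have -> : qtake 1 (arrow_path a) = arrow_path a by apply: val_inj.
Qed.

(** If a path p of positive length occurs in g then (p, p) occurs in g (x) g,
    so the concatenation pp occurs in g as well: the lengths of the paths in
    the support of g would be unbounded.  So g is a combination of vertices,
    and two distinct vertices x, y do not both occur because (x, y) does not
    occur in the comultiplication of any path. *)
Lemma grouplike_vertex (g : H) : d g = g \ox g -> eps g = 1 ->
  exists x, g = << vertex_path x >>.
Proof.
move=> dg eg.
have split p q : g@_p != 0 -> g@_q != 0 ->
    exists r i,
      [/\ (i <= qlength r)%N, g@_r != 0, p = qdrop i r & q = qtake i r].
  by move=> gp gq; apply: comul_support; rewrite dg mcoeff_tens mulf_neq0.
have len0 r : g@_r != 0 -> qlength r = 0%N.
  move=> gr; apply/eqP; rewrite -leqn0 leqNgt; apply/negP => r_gt0.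
  have long n : exists2 p, g@_p != 0 & (n < qlength p)%N.
    elim: n => [|n [p gp np]]; first by exists r.
    have [q [i [iq gq pd pt]]] := split p p gp gp.
    exists q; first exact: gq.
    move: (congr1 (@qlength Q) pt) (congr1 (@qlength Q) pd) np (iq).
    by rewrite (qlength_qtake iq) qlength_qdrop; lia.
  have [p gp] := long (\max_(p <- msupp g) qlength p).
  rewrite mcoeff_neq0 in gp.
  by rewrite ltnNge (@leq_bigmax_seq _ _ xpredT (@qlength Q) p gp isT).
have [r gr] : exists r, g@_r != 0.
  case: (fset_0Vmem (msupp g)) => [g0|[r rg]].
    move/eqP: eg; rewrite /path_counit /= /lext g0 big_seq_fset0 eq_sym.
    by rewrite oner_eq0.
  by exists r; rewrite mcoeff_neq0.
have uniq_r s : g@_s != 0 -> s = r.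
  move=> gs; have [q [i [iq _ rd st]]] := split r s gr gs.
  have i0 : i = 0%N by rewrite -(qlength_qtake iq) -st len0.
  move: rd st; rewrite i0 qdrop0 => <- ->.
  by rewrite -[RHS](qtake_all r) len0.
have gE : g = g@_r *: << r >>.
  apply/malgP => s; rewrite mcoeffZ mcoeffU; case: eqP => [<-|rs].
    by rewrite mulr1.
  by rewrite mulr0; apply/eqP; apply: contraT => /uniq_r sr; case: rs.
exists (qstart r); rewrite gE -(qlength0P (len0 _ gr)).
have -> : g@_r = 1; last by rewrite scale1r.
move: eg; rewrite gE linearZ /= path_counitU (len0 _ gr) eqxx [LHS]mulr1.
by rewrite mcoeffZ mcoeffUU mulr1.
Qed.

End PathCoefficients.

(** * Counting arrows *)

Lemma linear_sumZ_of (k : fieldType) (U V : lmodType k) (f : U -> V)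
    (I : Type) (r : seq I) (c : I -> k) (u : I -> U) :
  linear f -> f (\sum_(i <- r) c i *: u i) = \sum_(i <- r) c i *: f (u i).
Proof.
move=> lf; elim: r => [|i r IHr]; last by rewrite !big_cons lf IHr.
by rewrite !big_nil -(scale0r 0) (linearZ_of _ _ lf) scale0r.
Qed.

Section SkewPrimitivePaths.

Variables (k : fieldType) (Q : quiver).
Local Notation H := {malg k[qpath Q]}.
Local Notation d := (@path_comul k Q).

(** A path of length at least 2 splits into two pieces of positive length,
    whereas one factor of each term of the comultiplication of w is a vertex.
    For an arrow, the splittings into the arrow and one of its ends show that
    these ends are x and y. *)
Lemma skew_primitive_support (w : H) x y p :
  d w = << vertex_path y >> \ox w + w \ox << vertex_path x >> ->
  w@_p != 0 -> (0 < qlength p)%N ->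
  exists2 a, p = arrow_path a & src a = x /\ tgt a = y.
Proof.
move=> dw wp p_gt0.
have E i : (i <= qlength p)%N -> w@_p =
    (vertex_path y == qdrop i p)%:R * w@_(qtake i p)
    + w@_(qdrop i p) * (vertex_path x == qtake i p)%:R.
  move=> ip; rewrite -[LHS](mcoeff_comul_split w ip) dw mcoeffD.
  by rewrite -> !mcoeff_tens, !mcoeffU.
have neq (z : vertex Q) (q : qpath Q) :
    (0 < qlength q)%N -> (vertex_path z == q) = false.
  by move=> q_gt0; apply/eqP => zq; move: q_gt0; rewrite -zq.
have p1 : qlength p = 1%N.
  apply/eqP; rewrite eqn_leq p_gt0 andbT leqNgt; apply/negP => p_gt1.
  case/eqP: wp; rewrite (E 1%N p_gt0) !neq ?mul0r ?mulr0 ?addr0 //.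
    by rewrite qlength_qtake.
  by rewrite qlength_qdrop subn_gt0.
have [a pa] := qlength1P p1; exists a => //.
split; apply/eqP; apply: contraT => ne; case/eqP: wp.
  rewrite (E 0%N (leq0n _)) qdrop0 (neq _ _ p_gt0) mul0r add0r.
  case: eqP => [xt|]; last by rewrite mulr0.
  by case/eqP: ne; move/(congr1 (@qstart Q)): xt; rewrite pa.
rewrite (E 1%N p_gt0) [vertex_path x == _]neq ?qlength_qtake // mulr0 addr0.
case: eqP => [yd|]; last by rewrite mul0r.
by case/eqP: ne; move/(congr1 (@qstart Q)): yd; rewrite pa.
Qed.

Definition vertex_supported (w : H) : Prop :=
  forall p, (0 < qlength p)%N -> w@_p = 0.

Lemma vertex_supported_vertex x : vertex_supported << vertex_path x >>.
Proof.
move=> p p_gt0; rewrite mcoeffU; case: eqP => // E.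
by move: p_gt0; rewrite -E.
Qed.

End SkewPrimitivePaths.

Section ArrowCount.

Variables (k : fieldType) (Q : quiver) (M : majid_algebra (path_coalgebra k Q)).
Local Notation H := {malg k[qpath Q]}.
Local Notation mul := (mj_mul M).
Local Notation phi := (mj_phi M).
Local Notation one := (mj_one M).
Local Notation "a \m b" := (mul (a \ox b)) (at level 40, left associativity).

Variables (G : groupType) (g : G -> vertex Q).
Local Notation v x := (<< vertex_path (g x) >> : H).
Hypothesis g_bij : bijective g.
Hypothesis vM : forall x y, v x \m v y = v (x * y)%g.
Hypothesis v1 : one = v 1%g.

Lemma linear_prod_vertex x : linear (fun w : H => w \m v x).
Proof. by apply: linear_comp; apply: linear_tensl. Qed.

Lemma vertex_supported_mul (w : H) x :
  vertex_supported w -> vertex_supported (w \m v x).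
Proof.
move=> sw q q_gt0; have [f gK fK] := g_bij.
(* L is the projection onto the span of the vertices. *)
pose L := lext (fun p : qpath Q => if qlength p == 0%N then << p >> else 0 : H).
have -> : w = L w.
  apply/malgP => p; case: (posnP (qlength p)) => [p0|p_gt0].
    move: w {sw}; apply: (@linear_ext k (qpath Q) k^o) => [||r].
    - exact: linear_mcoeff.
    - by apply: linear_mcoeff; apply: linearP.
    rewrite /L lextU; case: eqP => // /eqP r0; rewrite mcoeff0 mcoeffU.
    by case: eqP => // rp; rewrite rp p0 in r0.
  rewrite sw //; move: w {sw}; apply: (@linear_ext k (qpath Q) k^o) => [||r].
  - by move=> c u u'; rewrite scaler0 addr0.
  - by apply: linear_mcoeff; apply: linearP.
  rewrite /L lextU; case: eqP => [r0|_]; last by rewrite mcoeff0.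
  by rewrite mcoeffU; case: eqP => // rp; rewrite rp in r0; rewrite r0 in p_gt0.
move: w {sw}; apply: (@linear_ext k (qpath Q) k^o) => [||r].
- apply: linear_mcoeff; apply: linear_comp; apply: linear_tensl.
  exact: linearP.
- by move=> c u u'; rewrite scaler0 addr0.
rewrite /L lextU; case: eqP => [r0|_].
  rewrite (qlength0P r0) -(fK (qstart r)); rewrite -> vM.
  exact: vertex_supported_vertex.
by rewrite -(scale0r 0) (linearZ_of _ _ (linear_prod_vertex x)) scale0r mcoeff0.
Qed.

Lemma skew_primitive_arrow (x y : G) a : src a = g x -> tgt a = g y ->
  skew_primitive (C := path_coalgebra k Q) (fun x => v x) x y
    << arrow_path a >>.
Proof. by move=> sa ta V F; rewrite [LHS]sweedler2_arrow sa ta. Qed.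

(** Let N be the matrix, in the arrows A from x to y and B from xz to yz, of
    right multiplication by z followed by the projection onto the arrows.  If
    u N = 0, the combination W = (sum of the u_i a_i) z is supported on
    vertices, and so is W z^-1.  But modulo vertices W z^-1 is a nonzero
    multiple of the sum of the u_i a_i, so u = 0: the rows of N are
    independent. *)
Lemma leq_arrow_count (x y z : G) (A B : seq (arrow Q)) :
  uniq A -> (forall a, a \in A -> src a = g x /\ tgt a = g y) ->
  (forall b, src b = g (x * z)%g -> tgt b = g (y * z)%g -> b \in B) ->
  (size A <= size B)%N.
Proof.
move=> uA AP BP.
have sv (V : lmodType k) (F : H -> H -> V) t :
    \sw[comul (path_coalgebra k Q)]_(a1, a2 <- v t) F a1 a2 = F (v t) (v t).
  exact: sweedler2_vertex.
pose a i := tnth (in_tuple A) i; pose b j := tnth (in_tuple B) j.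
have aP i : src (a i) = g x /\ tgt (a i) = g y by apply/AP/mem_tnth.
have sk i : skew_primitive (C := path_coalgebra k Q) (fun x => v x) x y
    << arrow_path (a i) >>.
  by have [sa ta] := aP i; apply: skew_primitive_arrow.
pose N : 'M[k]_(size A, size B) :=
  \matrix_(i, j) (<< arrow_path (a i) >> \m v z)@_(arrow_path (b j)).
suff /eqP <- : row_free N by apply: rank_leq_col.
apply: inj_row_free => u uN; apply/rowP => j; rewrite mxE.
pose W : H := \sum_(i < size A) u 0 i *: (<< arrow_path (a i) >> \m v z).
have sW : vertex_supported W.
  move=> p p_gt0; rewrite raddf_sum /=.
  have [/existsP[i ip]|] :=
    boolP [exists i, (<< arrow_path (a i) >> \m v z)@_p != 0].
    have dw := skew_primitive_mul (C := path_coalgebra k Q) (M := M)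
      (v := fun x => v x) sv vM z (sk i).
    have [c pc [sc tc]] := skew_primitive_support dw ip p_gt0.
    have /tnthP[l cl] : c \in in_tuple B by apply: BP.
    have := congr1 (fun A : 'rV_ _ => A 0 l) uN; rewrite !mxE => {2}<-.
    apply: eq_bigr => i' _; rewrite mcoeffZ mxE.
    by rewrite pc cl.
  rewrite negb_exists => /forallP z0; rewrite big1 // => i _.
  by rewrite mcoeffZ; move/negbNE: (z0 i) => /eqP->; rewrite mulr0.
pose P := arrow_path (a j).
have sWz := vertex_supported_mul z^-1%g sW (p := P) isT.
have nz : phi (v x \ox v z \ox v z^-1%g) != 0.
  apply: (phi_v_neq0 (C := path_coalgebra k Q) M (v := fun x => v x) sv).
  by move=> t; rewrite /= path_counitU.
(* skew_primitive_mulK read off at the arrow a_j, where vertices vanish. *)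
have E i : phi (v x \ox v z \ox v z^-1%g) * (<< arrow_path (a i) >> : H)@_P
  = phi (v y \ox v z \ox v z^-1%g)
    * ((<< arrow_path (a i) >> \m v z) \m v z^-1%g)@_P.
  have := congr1 (mcoeff P) (skew_primitive_mulK (C := path_coalgebra k Q)
    (M := M) (v := fun x => v x) sv vM v1 z (sk i)).
  have vP t : (v t)@_P = 0 by apply: vertex_supported_vertex.
  rewrite [LHS]mcoeffZ [RHS]mcoeffD [X in X + _]mcoeffZ [X in _ + X]mcoeffZ.
  rewrite [X in _ + _ * X]mcoeffB.
  rewrite -> !vP; have alg (p q s : k) : p = q + s * (0 - 0) -> p = q.
    by move=> ->; rewrite subrr mulr0 addr0.
  exact: alg.
have WP : \sum_(i < size A)
    u 0 i * ((<< arrow_path (a i) >> \m v z) \m v z^-1%g)@_P = 0.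
  rewrite -[RHS]sWz; apply/esym.
  apply: (@linear_sumZ_of k H k^o (fun w => (w \m v z^-1%g)@_P)).
  by apply: linear_mcoeff; apply: linear_prod_vertex.
have aE i : (<< arrow_path (a i) >> : H)@_P = (i == j)%:R.
  rewrite mcoeffU; congr (nat_of_bool _)%:R.
  by rewrite (inj_eq (@arrow_path_inj Q)) /a !(tnth_nth (a j)) nth_uniq.
have alg (c c' : k) (s t : 'I_(size A) -> k) : c != 0 ->
    (forall i, c * t i = c' * s i) -> \sum_i u 0 i * s i = 0 ->
    (forall i, t i = (i == j)%:R) -> u 0 j = 0.
  move=> c0 cts us0 tE; apply: (mulfI c0).
  rewrite mulr0 -(mulr0 c') -us0 mulr_sumr.
  under eq_bigr do rewrite mulrCA -cts mulrCA tE.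
  rewrite (bigD1 j) //= eqxx mulr1 big1 ?addr0 // => i /negbTE->.
  by rewrite !mulr0.
exact: alg nz E WP aE.
Qed.

End ArrowCount.

(** * Recognizing a Hopf quiver *)

Section HopfQuiverIso.

Variables (Q : quiver) (G : groupType) (f : vertex Q -> G) (g : G -> vertex Q).
Hypotheses (fK : cancel f g) (gK : cancel g f).
Hypothesis mulgC : forall x y : G, commute x y.
Variable arrows : vertex Q -> vertex Q -> seq (arrow Q).
Hypothesis arrowsP : forall x y a,
  (a \in arrows x y) = (src a == x) && (tgt a == y).
Hypothesis arrows_uniq : forall x y, uniq (arrows x y).
Hypothesis size_arrows : forall x c,
  size (arrows (g x) (g (c * x)%g)) = size (arrows (g 1%g) (g c)).

Lemma arrow_ramificationJ (x y : G) :
  size (arrows (g 1%g) (g (x ^ y)%g)) = size (arrows (g 1%g) (g x)).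
Proof. by rewrite conjgE [(x * y)%g]mulgC mulgA mulVg mul1g. Qed.

(** In an abelian group conjugacy classes are singletons, so that any function
    is a ramification datum. *)
Definition arrow_ramification : ramification G :=
  Ramification (ram := fun c => size (arrows (g 1%g) (g c)))
    arrow_ramificationJ.
Local Notation R := arrow_ramification.

Definition degree (a : arrow Q) : G := (f (tgt a) * (f (src a))^-1)%g.

Lemma degreeK a : (degree a * f (src a))%g = f (tgt a).
Proof. by rewrite /degree -mulgA mulVg mulg1. Qed.

Lemma rank_lt a : (index a (arrows (src a) (tgt a)) < R (degree a))%N.
Proof.
rewrite /= -(size_arrows (f (src a))) degreeK !fK index_mem.
by rewrite arrowsP !eqxx.
Qed.

(** An arrow from x to c x is numbered by its position in the list of all of
    them, whose size depends on c alone. *)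
Definition arrow_coordinates (a : arrow Q) : arrow (hopf_quiver R) :=
  (f (src a), Tagged (fun c : G => 'I_(R c)) (Ordinal (rank_lt a))).

(** The type of the ordinals depends on the tags, so the ordinals are compared
    as natural numbers. *)
Lemma coordinates_eq (x y : G) (u w : {c : G & 'I_(R c)}) :
  x = y -> tag u = tag w -> tagged u = tagged w :> nat -> (x, u) = (y, w).
Proof.
case: u w => [c i] [e j] /= -> ce; case: e / ce j => j ij.
by congr (_, existT _ _ _); apply: val_inj.
Qed.

Lemma arrow_coordinates_inj : injective arrow_coordinates.
Proof.
move=> a b ab.
have sE : src a = src b by apply: (can_inj fK); case: ab.
have tE : tgt a = tgt b.
  apply: (can_inj fK); rewrite -!degreeK sE.
  by have /(congr1 (fun u => tag u.2)) := ab => /= ->.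
have iE : index a (arrows (src a) (tgt a)) = index b (arrows (src b) (tgt b)).
  by have /(congr1 (fun u => nat_of_ord (tagged u.2))) := ab.
have aP : a \in arrows (src a) (tgt a) by rewrite arrowsP !eqxx.
have bP : b \in arrows (src a) (tgt a) by rewrite arrowsP sE tE !eqxx.
by rewrite -(nth_index a aP) iE -sE -tE nth_index.
Qed.

Lemma arrow_coordinates_surj u : exists a, arrow_coordinates a == u.
Proof.
case: u => x [c i].
have iR : (i < size (arrows (g x) (g (c * x)%g)))%N by rewrite size_arrows.
have [a0 _] : exists a, a \in arrows (g x) (g (c * x)%g).
  by case: (arrows _ _) iR => // a s _; exists a; rewrite mem_head.
exists (nth a0 (arrows (g x) (g (c * x)%g)) i).
set a := nth _ _ _.
have : a \in arrows (g x) (g (c * x)%g) by apply: mem_nth.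
rewrite arrowsP => /andP[/eqP sa /eqP ta].
apply/eqP/coordinates_eq => /=.
- by rewrite sa gK.
- by rewrite /degree sa ta !gK mulgK.
- by rewrite sa ta index_uniq.
Qed.

Lemma exists_hopf_quiver_iso : inhabited (quiver_iso Q (hopf_quiver R)).
Proof.
split; apply: (@QuiverIso Q (hopf_quiver R) f arrow_coordinates).
- by exists g.
- exists (fun u => xchoose (arrow_coordinates_surj u)) => [a|u].
    apply: arrow_coordinates_inj.
    exact/eqP/(xchooseP (arrow_coordinates_surj _)).
  exact/eqP/(xchooseP (arrow_coordinates_surj u)).
- by [].
- by move=> a; apply: degreeK.
Qed.

End HopfQuiverIso.

(** * Hopf quivers of abelian groups *)

Theorem proposition3p1 (k : fieldType) (Q : quiver)
    (hQ : finite_multiplicities Q) :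
  admits_coquasitriangular_majid (path_coalgebra k Q) <->
  exists (G : groupType) (R : ramification G),
    (forall x y : G, commute x y) /\ inhabited (quiver_iso Q (hopf_quiver R)).
Proof.
split; last first.
  move=> [G [R [mulgC [iso]]]].
  have [vertex_of iso_vertexK vertex_ofK] := iso_vertex_bij iso.
  have [arrow_of iso_arrowK arrow_ofK] := iso_arrow_bij iso.
  exact: (hopf_quiver_coquasitriangular iso_vertexK vertex_ofK
    iso_arrowK arrow_ofK).
move=> [M [cqM]].
(* The finite lists of arrows between two vertices are chosen all at once. *)
have [arrows arrowsP] : exists arrows : vertex Q * vertex Q -> seq (arrow Q),
    forall xy, uniq (arrows xy)
    /\ forall a, (a \in arrows xy) = (src a == xy.1) && (tgt a == xy.2).
  apply: (functional_choice (fun xy s => uniq s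
    /\ forall a, (a \in s) = (src a == xy.1) && (tgt a == xy.2))) => -[x y].
  have [s sP] := hQ x y.
  exists (undup [seq a <- s | (src a == x) && (tgt a == y)]).
  split; first exact: undup_uniq.
  move=> a; rewrite mem_undup mem_filter andb_idr //.
  by case/andP => /eqP sa /eqP ta; apply: sP.
have v_inj : injective (fun x : vertex Q =>
    << vertex_path x >> : {malg k[qpath Q]}).
  move=> x y /(congr1 (mcoeff (vertex_path y))); rewrite -> !mcoeffU.
  rewrite eqxx; case: eqP => [/vertex_path_inj //|_] /esym/eqP.
  by rewrite oner_eq0.
have eps_v x : counit (path_coalgebra k Q) << vertex_path x >> = 1.
  by rewrite /= path_counitU.
have [G [f [g [fK gK v1 vM mulgC]]]] := exists_vertex_group cqM
  v_inj (@sweedler2_vertex k Q) eps_v (@grouplike_vertex k Q).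
have g_bij : bijective g by exists f.
have arrows_uniq x y : uniq (arrows (x, y)) by have [] := arrowsP (x, y).
have mem_arrows x y a : (a \in arrows (x, y)) = (src a == x) && (tgt a == y).
  by have [_ ->] := arrowsP (x, y).
have le_size x y z : (size (arrows (g x, g y))
    <= size (arrows (g (x * z)%g, g (y * z)%g)))%N.
  apply: (leq_arrow_count (x := x) (y := y) (z := z) g_bij vM v1
    (arrows_uniq _ _)) => [a|b sb tb].
    by rewrite mem_arrows => /andP[/eqP-> /eqP->].
  by rewrite mem_arrows; apply/andP; split; apply/eqP.
have size_arrows x c :
    size (arrows (g x, g (c * x)%g)) = size (arrows (g 1%g, g c)).
  apply/eqP; rewrite eqn_leq; apply/andP; split.
    by have := le_size x (c * x)%g x^-1%g; rewrite mulgV mulgK.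
  by have := le_size 1%g c x; rewrite mul1g.
exists G, (arrow_ramification g mulgC (fun x y => arrows (x, y))); split => //.
exact: (exists_hopf_quiver_iso fK gK mulgC mem_arrows arrows_uniq size_arrows).
Qed.
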